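(* Not every covering of the open annulus is semiconjugate to $m_d$: there exist an integer $d$ with $|d|>1$ and a covering map $f:A\to A$ of degree $d$ of the open annulus $A=(0,1)\times S^1$ such that $f$ is not semiconjugate to $m_d$.
   Context: $m_d:S^1\to S^1$, $m_d(z)=z^d$. The degree of $f$ is the integer $d$ such that $f_*$ is multiplication by $d$ on $H_1(A,\mathbb{Z})\cong\mathbb{Z}$. The map $f$ is semiconjugate to $m_d$ if there exists a continuous map $h:A\to S^1$ with $hf=m_dh$ such that $h_*:H_1(A,\mathbb{Z})\to H_1(S^1,\mathbb{Z})$ is an isomorphism. *)

(* Defs.v *)
From HB Require Import structures.
(* freeg comes first: its lift would otherwise hide fintype.lift. *)
From mathcomp Require Import freeg.
From mathcomp Require Import all_boot all_order all_algebra ring_quotient.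
From mathcomp Require Import complex.
From mathcomp Require Import all_classical all_reals all_analysis.
Import numFieldNormedType.Exports.
Set Implicit Arguments.
Unset Strict Implicit.
Unset Printing Implicit Defensive.
Import Order.TTheory GRing.Theory Num.Theory.
Local Open Scope quotient_scope.
Local Open Scope classical_set_scope.
Local Open Scope ring_scope.

Section CoveringMap.
Context {X Y : topologicalType}.

(* p restricts to a homeomorphism from V onto U; s is its inverse, with junk
   values outside U. *)
Definition homeo_on (p : X -> Y) (V : set X) (U : set Y) : Prop :=
  [/\ set_bij V U p, {within V, continuous p} &
      exists s : Y -> X, {within U, continuous s} /\ {in V, cancel p s}].

Definition evenly_covered (p : X -> Y) (U : set Y) : Prop :=
  exists2 sheets : set (set X),
    p @^-1` U = \bigcup_(V in sheets) V /\ trivIset sheets id &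
    forall V, sheets V -> open V /\ homeo_on p V U.

Definition covering_map (p : X -> Y) : Prop :=
  [/\ continuous p, set_surj setT setT p &
      forall y, exists U : set Y, [/\ open U, U y & evenly_covered p U]].

End CoveringMap.

Section Simplex.
Variable R : realType.

Definition simplex_set n : set 'rV[R]_n.+1 :=
  [set x | (forall i, 0 <= x 0 i) /\ \sum_i x 0 i = 1].
Arguments simplex_set : clear implicits.

Definition simplex n : topologicalType := set_type (simplex_set n).

(* Inserts a zero coordinate at position i. *)
Definition face_row n (i : 'I_n.+2) (x : 'rV[R]_n.+1) : 'rV[R]_n.+2 :=
  \row_j (if unlift i j is Some k then x 0 k else 0).

Lemma face_row_simplex n (i : 'I_n.+2) (x : simplex n) :
  face_row i (set_val x) \in simplex_set n.+1.
Proof.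
case: x => x xS; move: (set_mem xS) => [x0 x1].
apply/mem_set; split => [j|]; rewrite ?mxE.
  by case: unliftP => // k _; exact: x0.
rewrite (bigD1_ord i)//= !mxE unlift_none add0r -[RHS]x1.
by apply: eq_bigr => k _; rewrite mxE liftK.
Qed.

Definition face_fun n (i : 'I_n.+2) (x : simplex n) : simplex n.+1 :=
  exist _ (face_row i (set_val x)) (face_row_simplex i x).

Lemma face_row_continuous n (i : 'I_n.+2) : continuous (@face_row n i).
Proof.
move=> x B [P Px PB]; exists (fun a k => P 0 (lift i k)) => [a k|y Py].
  by have := Px 0 (lift i k); rewrite mxE liftK ord1.
apply: PB => a j; rewrite ord1 mxE.
case: unliftP (Px 0 j) => [k ->|->]; rewrite mxE ?liftK ?unlift_none.
  by move=> _; exact: (Py 0 k).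
exact: nbhs_singleton.
Qed.

Lemma face_continuous n (i : 'I_n.+2) : continuous (@face_fun n i).
Proof.
apply: continuous_comp_initial => x.
apply: (@continuous_comp _ _ _ set_val (@face_row n i)).
  exact: initial_continuous.
exact: face_row_continuous.
Qed.

Definition face n (i : 'I_n.+2) : continuousType (simplex n) (simplex n.+1) :=
  mkcts (@face_continuous n i).

End Simplex.

Definition fcomp {X Y Z : topologicalType}
    (f : continuousType X Y) (g : continuousType Y Z) : continuousType X Z :=
  g \o f.

Section Homology.
Variable R : realType.

Definition chain (X : topologicalType) n : lmodType int :=
  {freeg (continuousType (simplex R n) X) / int}.

Definition boundary (X : topologicalType) n : chain X n.+1 -> chain X n :=
  fglift (fun s : continuousType (simplex R n.+1) X =>
    \sum_(i < n.+2) (-1) ^+ i *: << fcomp (face R i) s >>).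

Definition push (X Y : topologicalType) (f : continuousType X Y) n :
    chain X n -> chain Y n :=
  fglift (fun s : continuousType (simplex R n) X => << fcomp s f >>).

HB.instance Definition _ (X : topologicalType) n :=
  GRing.isZmodMorphism.Build (chain X n.+1) (chain X n) (@boundary X n)
    (lift_is_additive _).

HB.instance Definition _ (X Y : topologicalType) (f : continuousType X Y) n :=
  GRing.isZmodMorphism.Build (chain X n) (chain Y n) (@push X Y f n)
    (lift_is_additive _).

Lemma boundaryU (X : topologicalType) n (k : int)
    (s : continuousType (simplex R n.+1) X) :
  boundary (<< k *g s >> : chain X n.+1) =
  k *: \sum_(i < n.+2) (-1) ^+ i *: << fcomp (face R i) s >>.
Proof. exact: liftU. Qed.

Lemma pushU (X Y : topologicalType) (f : continuousType X Y) n (k : int)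
    (s : continuousType (simplex R n) X) :
  push f (<< k *g s >> : chain X n) = k *: << fcomp s f >>.
Proof. exact: liftU. Qed.

Lemma push_boundary (X Y : topologicalType) (f : continuousType X Y) n
    (c : chain X n.+1) : boundary (push f c) = push f (boundary c).
Proof.
have addZ (U V : lmodType int) (g : {additive U -> V}) (k : int) (u : U) :
    g (k *: u) = k *: g u.
  by rewrite -[k]intz !scaler_int raddfMz.
elim/freeg_ind_dom0: c => [|k s c _ _ IHc]; first by rewrite !raddf0.
rewrite !raddfD/= IHc pushU boundaryU !addZ; congr (_ *: _ + _).
rewrite /= boundaryU scale1r raddf_sum; apply: eq_bigr => i _.
rewrite addZ/= pushU scale1r; congr (_ *: << _ >>).
by apply/continuousEP.
Qed.

Section H1.
Variable X : topologicalType.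

Definition is_cycle : {pred chain X 1} := [pred c | boundary c == 0].

Lemma is_cycle_zmod_closed : zmod_closed is_cycle.
Proof.
split=> [|c c']; rewrite !inE ?raddf0//= => /eqP c0 /eqP c'0.
by rewrite raddfB/= c0 c'0 subr0.
Qed.

HB.instance Definition _ :=
  GRing.isZmodClosed.Build (chain X 1) is_cycle is_cycle_zmod_closed.

Record cycle := Cycle { cycle_chain :> chain X 1; _ : is_cycle cycle_chain }.
HB.instance Definition _ := [isSub for cycle_chain].
HB.instance Definition _ := [Choice of cycle by <:].
HB.instance Definition _ := [SubChoice_isSubZmodule of cycle by <:].

(* Only 1-cycles that are boundaries of 2-chains, as a subgroup of the group of
   1-cycles, so that the quotient below is Z_1 / B_1. *)
Definition is_boundary : {pred cycle} :=
  fun z => `[< exists b : chain X 2, boundary b = cycle_chain z >].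

Lemma is_boundary_zmod_closed : zmod_closed is_boundary.
Proof.
split; first by apply/asboolP; exists 0; rewrite raddf0.
move=> z z' /asboolP[b bz] /asboolP[b' bz']; apply/asboolP; exists (b - b').
by rewrite raddfB/= bz bz'.
Qed.

HB.instance Definition _ :=
  GRing.isZmodClosed.Build cycle is_boundary is_boundary_zmod_closed.

Definition H1 : zmodType := Quotient.quot is_boundary.

End H1.

Section H1map.
Context {X Y : topologicalType} (f : continuousType X Y).

Lemma push_cycle (z : cycle X) : is_cycle (push f (cycle_chain z)).
Proof.
by case: z => c /= /eqP c0; rewrite /is_cycle/= push_boundary c0 raddf0.
Qed.

Definition cycle_push (z : cycle X) : cycle Y := Cycle (push_cycle z).

(* H1_map_pi below shows that the result does not depend on the representative
   and H1_map_is_zmod_morphism that it is a group homomorphism. *)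
Definition H1_map (a : H1 X) : H1 Y := \pi_(H1 Y) (cycle_push (repr a)).

Lemma H1_map_pi (z : cycle X) :
  H1_map (\pi_(H1 X) z) = \pi_(H1 Y) (cycle_push z).
Proof.
apply/eqP; rewrite /H1_map -Quotient.idealrBE; apply/asboolP.
have /asboolP[b bz] : repr (\pi_(H1 X) z) - z \in @is_boundary X.
  by rewrite Quotient.idealrBE reprK.
by exists (push f b); rewrite push_boundary bz !raddfB.
Qed.

Lemma H1_map_is_zmod_morphism : zmod_morphism H1_map.
Proof.
move=> a b; rewrite -[a]reprK -[b]reprK -raddfB !H1_map_pi -raddfB.
by congr (\pi_(_) _); apply: val_inj; rewrite /= !raddfB.
Qed.

HB.instance Definition _ :=
  GRing.isZmodMorphism.Build (H1 X) (H1 Y) H1_map H1_map_is_zmod_morphism.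

End H1map.
End Homology.
Arguments H1_map R {X Y}.

Section Annulus.
Variable R : realType.

(* The regular module R[i]^o is the copy of the field R[i] that carries the
   topology of the complex modulus. *)
Definition circle_set : set (R[i]^o) := [set z | `|z| = 1].
Definition circle : topologicalType := set_type circle_set.
Definition open_unit : topologicalType := set_type (`]0%R, 1%R[%classic : set R).
Definition annulus : topologicalType := (open_unit * circle)%type.

Lemma circle_pow_subproof (d : int) (z : circle) :
  (set_val z : R[i]) ^ d \in circle_set.
Proof.
case: z => z zS; have z1 : `|z : R[i]| = 1 := set_mem zS.
apply/mem_set; change (`|(z : R[i]) ^ d| = 1).
by case: d => n; rewrite /exprz ?normfV normrX z1 expr1n ?invr1.
Qed.

Definition circle_pow (d : int) (z : circle) : circle :=
  exist _ ((set_val z : R[i]) ^ d) (circle_pow_subproof d z).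

Definition has_degree (f : continuousType annulus annulus) (d : int) : Prop :=
  forall a : H1 R annulus, H1_map R f a = a *~ d.

(* H1_map R h is a group homomorphism, hence an isomorphism iff bijective. *)
Definition semiconjugate_pow (f : annulus -> annulus) (d : int) : Prop :=
  exists h : continuousType annulus circle,
    h \o f = circle_pow d \o h /\ bijective (H1_map R h).

End Annulus.

(* Main.v *)
Require Import Defs.
From HB Require Import structures.
From mathcomp Require Import freeg.
From mathcomp Require Import all_boot all_order all_algebra ring_quotient.
From mathcomp Require Import complex.
From mathcomp Require Import all_classical all_reals all_analysis.
From mathcomp Require Import ring lra.
Import numFieldNormedType.Exports.
Set Implicit Arguments.
Unset Strict Implicit.
Unset Printing Implicit Defensive.
Import Order.TTheory GRing.Theory Num.Theory.
Local Open Scope classical_set_scope.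
Local Open Scope ring_scope.

(* Write the annulus as R x S^1. The example is
   f (t, z) = (t + ln (3 + Im w), w ^ 2) with w = z * exp (i * exp (exp t)):
   a homeomorphism of the annulus followed by squaring in the circle, hence a
   covering of degree 2. Lifted to the strip, it is
   F (t, x) = (t + ln (3 + sin y), 2 y) with y = x + exp (exp t).
   A semiconjugacy lifts to H with H o F = 2 H and
   H (t, x + 2 pi) = H (t, x) + 2 pi m, where m <> 0, so u = H - m x descends to
   the annulus and u o F = 2 u - 2 m exp (exp t). Since F increases t by at
   least ln 2, the values of u at height t are determined at lower heights,
   where exp (exp t) is much smaller, so that u = O (exp (exp t / 2)).
   On the other hand, f takes the same value at the points with coordinates
   (t, y = pi / 2) and (t + ln 2, y = 3 pi / 2), and this forces u to differ
   there by m (exp (2 exp t) - exp (exp t)), which is too much. *)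

(** * The circle *)

(** The obstruction sits at the noncompact end t -> +oo. Unfolding u o F = 2 u - 2 m exp (exp t)
    backwards, u is a weighted sum of forcing terms along the past orbit, plus an initial value
    doubled at every step. Each step at least doubles exp t, hence at least squares exp (exp t), so
    the last forcing term dominates the earlier ones and all the doublings; exp t alone would grow
    by bounded factors, just like the doublings. The 3 keeps 3 + sin y in [2, 4]; the extremes 4 and
    2 occur at y = pi / 2 and 3 pi / 2, and their ratio gives the offset ln 2 of the colliding
    points. Two facts about singular H_1 enter. Degree 2: modulo boundaries, f_* - 2 sends a path to
    the difference of one function at its end points, so it kills cycles. m <> 0: otherwise H
    descends to the annulus, every h_* c with c a cycle has winding number 0, and the class of the
    standard loop has no preimage. *)

Lemma continuous_at_comp_initial {Y : choiceType} {X Z : topologicalType}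
    (w : Y -> Z) (f : X -> initial_topology w) (x : X) :
  {for x, continuous (w \o f)} -> {for x, continuous f}.
Proof.
move=> cf U [?/= [[W oW <-]]] /= Wsfz /filterS; apply; apply: cf.
exact: open_nbhs_nbhs.
Qed.

Section CircleCoordinates.
Variable R : realType.
Implicit Types z w : circle R.

Definition cre z : R := complex.Re (set_val z : R[i]).
Definition cim z : R := complex.Im (set_val z : R[i]).

Lemma cre2Dcim2 z : cre z ^+ 2 + cim z ^+ 2 = 1.
Proof.
case: z => z zS; have z1 := set_mem zS; have := add_Re2_Im2 (z : R[i]).
have -> : `|z : R[i]| = 1 by exact: z1.
by rewrite expr1n => -[].
Qed.

Lemma circle_coords_proof (a b : R) : a ^+ 2 + b ^+ 2 = 1 ->
  (Complex a b : R[i]) \in @circle_set R.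
Proof.
move=> ab; apply/mem_set; rewrite /circle_set/=.
by rewrite [LHS]normc_def/= ab sqrtr1.
Qed.

Definition mkcircle (a b : R) (ab : a ^+ 2 + b ^+ 2 = 1) : circle R :=
  exist _ (Complex a b : R[i]) (circle_coords_proof ab).

Lemma circle_ext z w : cre z = cre w -> cim z = cim w -> z = w.
Proof.
move=> hre him; apply: val_inj; apply/eqP; rewrite eq_complex.
by apply/andP; split; apply/eqP.
Qed.

(** The norm of [R[i]] is itself [R[i]]-valued, so the radii of [cvgrPdist_lt] are complex; this
    lemma and its converse below trade them for real ones. *)
Lemma near_norm_lt (T : topologicalType) (f : T -> R[i]^o) (x : T) (e : R) :
  {for x, continuous f} -> 0 < e ->
  \forall y \near x, `|(f x : R[i]) - (f y : R[i])| < e%:C%C.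
Proof.
move=> fx e0; have eC : (0 : R[i]) < e%:C%C by rewrite ltcR.
by move/cvgrPdist_lt : fx => /(_ _ eC).
Qed.

Lemma near_norm_continuous (T : topologicalType) (f : T -> R[i]^o) (x : T) :
  (forall e : R, 0 < e ->
    \forall y \near x, `|(f x : R[i]) - (f y : R[i])| < e%:C%C) ->
  {for x, continuous f}.
Proof.
(* Positivity in [R[i]] includes a vanishing imaginary part, so the radius is real. *)
move=> fx; apply/cvgrPdist_lt => e; rewrite ltcE => /andP[/eqP/= e_im e_re].
have -> : e = (complex.Re e)%:C%C by case: e e_im {e_re} => a b /= ->.
exact: fx.
Qed.

Lemma Re_continuous_at (T : topologicalType) (f : T -> R[i]^o) (x : T) :
  {for x, continuous f} -> {for x, continuous (fun y => complex.Re (f y))}.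
Proof.
move=> fx; apply/cvgrPdist_lt => e /(near_norm_lt fx); apply: filterS => y.
rewrite -ltcR; apply: le_lt_trans; rewrite -raddfB; exact: normc_ge_Re.
Qed.

Lemma Im_continuous_at (T : topologicalType) (f : T -> R[i]^o) (x : T) :
  {for x, continuous f} -> {for x, continuous (fun y => complex.Im (f y))}.
Proof.
move=> fx; apply/cvgrPdist_lt => e /(near_norm_lt fx); apply: filterS => y.
(* Im w = - Re (w i), and multiplication by i preserves the modulus: this reduces to the bound for
   real parts. *)
rewrite -ltcR; apply: le_lt_trans; rewrite -raddfB -normrN -ReiNIm.
apply: le_trans (normc_ge_Re _) _; rewrite normrM.
have -> : `|'i%C : R[i]| = 1.
  by rewrite normc_def/= expr0n/= expr1n add0r sqrtr1.
by rewrite mulr1.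
Qed.

Lemma continuous_complex_at (T : topologicalType) (f : T -> R[i]^o) (x : T) :
  {for x, continuous (fun y => complex.Re (f y))} ->
  {for x, continuous (fun y => complex.Im (f y))} -> {for x, continuous f}.
Proof.
move=> /cvgrPdist_lt fre /cvgrPdist_lt fim; apply: near_norm_continuous => e e0.
have e20 : 0 < e / 2 by rewrite divr_gt0.
apply: filterS2 (fre _ e20) (fim _ e20) => y.
rewrite /= -!raddfB/=; set w := (X in complex.Re X) => re_lt im_lt.
rewrite -/w [w]complexE; apply: le_lt_trans (ler_normD _ _) _.
have ni : `|'i%C : R[i]| = 1.
  by rewrite normc_def/= expr0n/= expr1n add0r sqrtr1.
rewrite normrM ni mul1r !normc_def/= expr0n/= !addr0 !sqrtr_sqr -rmorphD/= ltcR.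
by rewrite [ltRHS]splitr ltrD.
Qed.

Let set_val_continuous : continuous (set_val : circle R -> R[i]^o).
Proof. exact: initial_continuous. Qed.

Lemma cre_continuous : continuous cre.
Proof.
by move=> z; apply: (@Re_continuous_at (circle R)); exact: set_val_continuous.
Qed.

Lemma cim_continuous : continuous cim.
Proof.
by move=> z; apply: (@Im_continuous_at (circle R)); exact: set_val_continuous.
Qed.

Lemma continuous_circle_at (T : topologicalType) (f : T -> circle R) (x : T) :
  {for x, continuous (fun y => cre (f y))} ->
  {for x, continuous (fun y => cim (f y))} ->
  {for x, continuous f}.
Proof.
move=> fre fim; apply: continuous_at_comp_initial.
exact: continuous_complex_at.
Qed.

End CircleCoordinates.

(** * The circle group, its exponential and a local logarithm *)

Section CircleGroup.
Variable R : realType.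
Implicit Types z w : circle R.

Lemma cmul_proof z w :
  (cre z * cre w - cim z * cim w) ^+ 2 + (cre z * cim w + cim z * cre w) ^+ 2
  = 1.
Proof.
rewrite -[RHS](mulr1 1) -{1}(cre2Dcim2 z) -(cre2Dcim2 w); ring.
Qed.

Definition cmul z w : circle R := mkcircle (cmul_proof z w).

Lemma cinv_proof z : cre z ^+ 2 + (- cim z) ^+ 2 = 1.
Proof. by rewrite sqrrN cre2Dcim2. Qed.

Definition cinv z : circle R := mkcircle (cinv_proof z).

Lemma cis_proof (x : R) : cos x ^+ 2 + sin x ^+ 2 = 1.
Proof. exact: cos2Dsin2. Qed.

Definition cis (x : R) : circle R := mkcircle (cis_proof x).

Lemma cmulE z w : (cre (cmul z w) = cre z * cre w - cim z * cim w) *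
  (cim (cmul z w) = cre z * cim w + cim z * cre w).
Proof. by []. Qed.

Lemma cinvE z : (cre (cinv z) = cre z) * (cim (cinv z) = - cim z).
Proof. by []. Qed.

Lemma cisE x : (cre (cis x) = cos x) * (cim (cis x) = sin x).
Proof. by []. Qed.

Lemma cis0E : (cre (cis 0) = 1) * (cim (cis 0) = 0).
Proof. by rewrite !cisE cos0 sin0. Qed.

Lemma cmulC : commutative cmul.
Proof. by move=> z w; apply: circle_ext; rewrite !cmulE; ring. Qed.

Lemma cmulA : associative cmul.
Proof. by move=> z w v; apply: circle_ext; rewrite !cmulE; ring. Qed.

Lemma cmul1 : right_id (cis 0) cmul.
Proof.
by move=> z; apply: circle_ext; rewrite !cmulE !cis0E; ring.
Qed.

Lemma cmulV z : cmul z (cinv z) = cis 0.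
Proof.
apply: circle_ext; rewrite !cmulE !cinvE cis0E; last ring.
by rewrite -(cre2Dcim2 z); ring.
Qed.

Lemma cmulK z w : cmul (cmul z w) (cinv w) = z.
Proof. by rewrite -cmulA cmulV cmul1. Qed.

Lemma cmulVK z w : cmul (cmul z (cinv w)) w = z.
Proof. by rewrite -cmulA [cmul (cinv w) _]cmulC cmulV cmul1. Qed.

Lemma cisD x y : cis (x + y) = cmul (cis x) (cis y).
Proof.
apply: circle_ext; rewrite !cmulE !cisE ?cosD ?sinD; ring.
Qed.

Lemma cisN x : cis (- x) = cinv (cis x).
Proof. by apply: circle_ext; rewrite !cinvE !cisE ?cosN ?sinN. Qed.

Lemma circle_pow2 z : circle_pow 2 z = cmul z z.
Proof.
have E : set_val (circle_pow 2 z) = (set_val z : R[i]) * (set_val z : R[i]).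
  exact: (expr2 (set_val z : R[i])).
by apply: circle_ext; rewrite !cmulE /cre /cim E; case: (set_val z : R[i]).
Qed.

Lemma cis_surj z : exists x, cis x = z.
Proof.
have h := cre2Dcim2 z.
have cre1 : -1 <= cre z <= 1.
  rewrite -ler_norml -(@ler_pXn2r _ 2) ?nnegrE// expr1n real_normK ?num_real//.
  by rewrite -h lerDl sqr_ge0.
have [im0|im0] := leP 0 (cim z).
  exists (acos (cre z)); apply: circle_ext; rewrite cisE ?acosK ?in_itv//.
  by rewrite sin_acos// -h addrAC subrr add0r sqrtr_sqr ger0_norm.
exists (- acos (cre z)); apply: circle_ext; rewrite cisE ?cosN ?sinN.
  by rewrite acosK ?in_itv.
by rewrite sin_acos// -h addrAC subrr add0r sqrtr_sqr ltr0_norm// opprK.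
Qed.

(** cos x = 1 - 2 sin^2 (x / 2), and the sine is positive on (0, pi). *)
Lemma cis_eq1_small x : `|x| < pi *+ 2 -> cis x = cis 0 -> x = 0.
Proof.
wlog x0 : x / 0 <= x => [hw xpi x1|].
  have [|x0] := leP 0 x; first by move=> x0; exact: hw.
  apply/eqP; rewrite -oppr_eq0; apply/eqP; apply: hw.
  - by rewrite oppr_ge0 ltW.
  - by rewrite normrN.
  - by rewrite cisN x1; apply: circle_ext; rewrite !cinvE !cis0E ?oppr0.
rewrite ger0_norm// => xpi /(congr1 (@cre R)); rewrite !cis0E cisE => c1.
apply/eqP; rewrite eq_le x0 andbT leNgt; apply/negP => xgt0.
have xE : x = (x / 2) *+ 2 by rewrite -mulr_natr divfK.
move: c1; rewrite xE cos_mulr2n cos2sin2.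
have : 0 < sin (x / 2) by apply: sin_gt0_pi; move: xpi; rewrite -mulr_natr; lra.
nra.
Qed.

Lemma cis_period x (k : int) : cis (x + (pi *+ 2) *~ k) = cis x.
Proof.
have pern (n : nat) s : cis (s + (pi *+ 2) *~ n) = cis s.
  apply: circle_ext; rewrite !cisE -pmulrn.
    by rewrite (periodicn (@cosD2pi R)).
  by rewrite (periodicn (@sinD2pi R)).
case: k => n; first exact: pern.
by rewrite NegzE -[in RHS](subrK ((pi *+ 2) *~ n.+1) x) pern mulrNz.
Qed.

Lemma cis_eq x y : cis x = cis y -> exists k : int, y = x + (pi *+ 2) *~ k.
Proof.
move=> xy; have p2 : 0 < pi *+ 2 :> R by rewrite mulrn_wgt0// pi_gt0.
pose k := Num.floor ((y - x) / (pi *+ 2)); exists k.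
have e1 : cis (y - x - (pi *+ 2) *~ k) = cis 0.
  by rewrite -mulrNz cis_period cisD cisN xy cmulV.
suff : y - x - (pi *+ 2) *~ k = 0 by move=> /eqP; rewrite subr_eq0 subr_eq
  addrC => /eqP.
apply: cis_eq1_small e1; have /andP[] := floor_itv ((y - x) / (pi *+ 2)).
rewrite -/k ler_pdivlMr// ltr_pdivrMr// intrD mulrDl !mulrzl mulr1z.
by move=> lo hi; rewrite ger0_norm; lra.
Qed.

Lemma continuous_cmul (T : topologicalType) (f g : T -> circle R) (x : T) :
  {for x, continuous f} -> {for x, continuous g} ->
  {for x, continuous (fun y => cmul (f y) (g y))}.
Proof.
move=> fx gx.
have fre : {for x, continuous (fun y => cre (f y))}.
  by apply: continuous_comp fx _; exact: cre_continuous.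
have gre : {for x, continuous (fun y => cre (g y))}.
  by apply: continuous_comp gx _; exact: cre_continuous.
have fim : {for x, continuous (fun y => cim (f y))}.
  by apply: continuous_comp fx _; exact: cim_continuous.
have gim : {for x, continuous (fun y => cim (g y))}.
  by apply: continuous_comp gx _; exact: cim_continuous.
apply: continuous_circle_at => /=.
  by apply: continuousB; apply: continuousM.
by apply: continuousD; apply: continuousM.
Qed.

Lemma continuous_cinv (T : topologicalType) (f : T -> circle R) (x : T) :
  {for x, continuous f} -> {for x, continuous (fun y => cinv (f y))}.
Proof.
move=> fx.
apply: continuous_circle_at => /=.
  by apply: continuous_comp fx _; exact: cre_continuous.
apply: continuousN.
by apply: continuous_comp fx _; exact: cim_continuous.
Qed.

Lemma cis_continuous : continuous cis.
Proof.
move=> x; apply: continuous_circle_at.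
- exact: continuous_cos.
- exact: continuous_sin.
Qed.

(** The angle of [z] on the right half circle, where it inverts [cis]; on the left half it is the
    angle of the mirror image. *)
Definition clog z : R := asin (cim z).

Lemma cim_itv z : -1 <= cim z <= 1.
Proof.
rewrite -ler_norml -(@ler_pXn2r _ 2) ?nnegrE// expr1n real_normK ?num_real//.
by rewrite -(cre2Dcim2 z) lerDr sqr_ge0.
Qed.

Lemma clogK z : 0 < cre z -> cis (clog z) = z.
Proof.
move=> z0; apply: circle_ext; rewrite cisE /clog; last first.
  by rewrite asinK// in_itv cim_itv.
rewrite cos_asin ?cim_itv// -(cre2Dcim2 z) addrK sqrtr_sqr gtr0_norm//.
Qed.

Lemma clog_le z : `|clog z| <= pi / 2.
Proof.
by rewrite ler_norml asin_geNpi2 ?cim_itv// asin_lepi2 ?cim_itv.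
Qed.

(** Both sides have the same [cis] and differ by at most 3 pi / 2, less than a period. *)
Lemma clogM z w : 0 < cre z -> 0 < cre w -> 0 < cre (cmul z w) ->
  clog (cmul z w) = clog z + clog w.
Proof.
move=> z0 w0 zw0; apply/eqP; rewrite -subr_eq0; apply/eqP.
apply: cis_eq1_small.
  apply: (@le_lt_trans _ _ (pi / 2 + (pi / 2 + pi / 2))).
    apply: le_trans (ler_normB _ _) _; rewrite lerD ?clog_le//.
    by apply: le_trans (ler_normD _ _) _; rewrite lerD ?clog_le.
  by rewrite -mulr_natr; have := pi_gt0 R; lra.
by rewrite cisD cisN cisD !clogK// cmulV.
Qed.

Lemma clog_continuous z : 0 < cre z -> {for z, continuous clog}.
Proof.
move=> z0; have h := cre2Dcim2 z; have h0 : 0 < cre z ^+ 2 by rewrite exprn_gt0.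
have im1 : -1 < cim z < 1.
  by have /andP[? ?] := cim_itv z; apply/andP; split; nra.
exact: (@continuous_comp (circle R) R R (@cim R) (@asin R) z
  (@cim_continuous R z) (continuous_asin im1)).
Qed.

End CircleGroup.

(** * Lifting to the line *)

Lemma continuous_pair_at (T U V : topologicalType) (f : T -> U) (g : T -> V)
    (x : T) : {for x, continuous f} -> {for x, continuous g} ->
  {for x, continuous (fun y => (f y, g y))}.
Proof. by move=> fx gx; apply: cvg_pair. Qed.

Lemma continuous_fst_at (T U : topologicalType) (x : T * U) :
  {for x, continuous (fun y : T * U => y.1)}.
Proof. exact: cvg_fst. Qed.

Lemma continuous_snd_at (T U : topologicalType) (x : T * U) :
  {for x, continuous (fun y : T * U => y.2)}.
Proof. exact: cvg_snd. Qed.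

Section Lifting.
Variables (R : realType) (X : topologicalType) (G : R * X -> circle R).
Hypotheses (G_cont : continuous G) (G0 : forall x, G (0, x) = cis 0).

Let step (d s : R) (x : X) : circle R :=
  cmul (G (s + d, x)) (cinv (G (s, x))).

(** At d = 0 every ratio is 1, inside the open right half circle; compactness of [0, 1] makes the
    neighbourhood uniform in [s]. *)
Let step_near (x0 : X) : \forall i \near ((0, x0) : R * X),
  forall s : R, `[0, 1]%classic s -> 0 < cre (step i.1 s i.2).
Proof.
have /compact_near_coveringP cov := @segment_compact R 0 1.
apply: (cov (R * X)%type (nbhs ((0, x0) : R * X))
  (fun i s => 0 < cre (step i.1 s i.2))) => s _.
pose g (q : R * (R * X)) : circle R :=
  cmul (G (q.1 + q.2.1, q.2.2)) (cinv (G (q.1, q.2.2))).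
have g_cont : {for (s, (0, x0)), continuous (fun q => cre (g q))}.
  apply: (@continuous_comp _ _ _ g (@cre R)); last exact: cre_continuous.
  apply: continuous_cmul.
    apply: (@continuous_comp _ _ _ (fun q : R * (R * X) => (q.1 + q.2.1,
      q.2.2)) G).
      apply: continuous_pair_at.
        apply: (@continuousD R R).
          exact: continuous_fst_at.
        apply: (@continuous_comp _ _ _ snd fst).
          exact: continuous_snd_at.
        exact: continuous_fst_at.
      apply: (@continuous_comp _ _ _ snd snd); exact: continuous_snd_at.
    exact: G_cont.
  apply: continuous_cinv.
  apply: (@continuous_comp _ _ _ (fun q : R * (R * X) => (q.1, q.2.2)) G).
    apply: continuous_pair_at; first exact: continuous_fst_at.
    apply: (@continuous_comp _ _ _ snd snd); exact: continuous_snd_at.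
  exact: G_cont.
have g0 : 0 < cre (g (s, (0, x0))) by rewrite /g/= addr0 cmulV cis0E.
exact: (g_cont _ (lt_nbhsr g0)).
Qed.

Let h (n : nat) : R := 2 ^- n.
Let S (n : nat) (x : X) : R :=
  \sum_(0 <= i < 2 ^ n) clog (step (h n) (i%:R * h n) x).
Let good (n : nat) (x : X) : Prop :=
  forall s : R, `[0, 1]%classic s -> 0 < cre (step (h n) s x).

Let good_near (x0 : X) :
  exists n0, \forall x \near x0, forall n, (n0 <= n)%N -> good n x.
Proof.
have [[A B] /= [A0 Bx] AB] := step_near x0.
have : \forall n \near \oo, A (h n).
  have : h n @[n --> \oo] --> (0 : R).
    rewrite /h; under eq_fun do rewrite -exprVn.
    by apply: cvg_expr; rewrite ger0_norm ?invr_ge0// invf_lt1// ltr1n.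
  exact.
move=> [n0 _ An]; exists n0; apply: filterS Bx => x Bx n n0n s s01.
apply: (AB (h n, x) _ s s01); split => //=; exact: An.
Qed.

Let hE n : h n = h n.+1 + h n.+1.
Proof. by rewrite /h exprS invfM; field. Qed.

Let grid n i : (i < 2 ^ n)%N -> `[0, 1]%classic (i%:R * h n).
Proof.
move=> i2; rewrite /= in_itv/= /h mulr_ge0//= ler_pdivrMr ?exprn_gt0// mul1r.
by rewrite -natrX ler_nat ltnW.
Qed.

(** A step of length [h n] is the product of two steps of length [h n.+1]; all three lie in the
    right half circle, where [clogM] applies. *)
Let SS n x : good n x -> good n.+1 x -> S n.+1 x = S n x.
Proof.
move=> gn gn1; rewrite /S.
have two (c : nat -> R) m :
    \sum_(0 <= i < 2 * m) c i = \sum_(0 <= i < m) (c i.*2 + c i.*2.+1).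
  elim: m => [|m IH]; first by rewrite !big_geq.
  by rewrite mulnS add2n !big_nat_recr//= IH -addrA mul2n.
rewrite expnS two; apply: eq_big_nat => i /andP[_ i2].
have e1 : i.*2%:R * h n.+1 = i%:R * h n.
  by rewrite (hE n) -muln2 natrM; ring.
have e2 : i.*2.+1%:R * h n.+1 = i%:R * h n + h n.+1.
  by rewrite (hE n) -muln2 -[_.+1]addn1 natrD natrM; ring.
rewrite e1 e2 addrC.
have hi : (i.*2.+1 < 2 ^ n.+1)%N.
  by rewrite expnS mul2n -doubleS leq_double.
have s1 := grid i2; have s2 := grid hi; rewrite e2 in s2.
have st : step (h n) (i%:R * h n) x =
    cmul (step (h n.+1) (i%:R * h n + h n.+1) x) (step (h n.+1) (i%:R * h n) x).
  by rewrite /step cmulA cmulVK -addrA -hE.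
rewrite st clogM//; [exact: gn1|exact: gn1|rewrite -st; exact: gn].
Qed.

Let SE n x : good n x -> cis (S n x) = G (1, x).
Proof.
move=> gn; suff H j : (j <= 2 ^ n)%N ->
    cis (\sum_(0 <= i < j) clog (step (h n) (i%:R * h n) x)) = G (j%:R * h n,
      x).
  by rewrite /S H// natrX /h divff// expf_neq0.
elim: j => [|j IH] jn; first by rewrite big_geq// mul0r G0.
rewrite big_nat_recr//= cisD IH ?(ltnW jn)// clogK; last exact/gn/grid.
rewrite cmulC /step cmulVK; congr (G (_, _)).
by rewrite -[j.+1]addn1 natrD; ring.
Qed.

Let S_cont n x : good n x -> {for x, continuous (S n)}.
Proof.
move=> gn.
suff H j : (j <= 2 ^ n)%N -> {for x, continuous (fun y : X =>
    \sum_(0 <= i < j) clog (step (h n) (i%:R * h n) y))} by exact: H.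
elim: j => [|j IH] jn.
  rewrite (_ : (fun y => _) = fun=> 0); first exact: cst_continuous.
  by apply/funext => y; rewrite big_geq.
rewrite (_ : (fun y => _) = (fun y =>
    \sum_(0 <= i < j) clog (step (h n) (i%:R * h n) y)) \+
    (fun y => clog (step (h n) (j%:R * h n) y))); last first.
  by apply/funext => y; rewrite big_nat_recr.
apply: continuousD; first exact/IH/ltnW.
apply: (@continuous_comp _ _ _ (step (h n) (j%:R * h n)) (@clog R)); last first.
  exact/clog_continuous/gn/grid.
have GG s : continuous (fun y : X => G (s, y)).
  move=> y; apply: (@continuous_comp _ _ _ (fun y : X => (s, y)) G).
    by apply: continuous_pair_at; [exact: cst_continuous|exact: cvg_id].
  exact: G_cont.
by apply: continuous_cmul; [exact: GG|apply: continuous_cinv; exact: GG].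
Qed.

(* The sum of the principal logarithms of the ratios of consecutive values of
   G(., x) over a dyadic subdivision of [0, 1] does not change under
   refinement, as soon as the subdivision is fine enough; this holds uniformly
   for x in a neighbourhood by compactness of [0, 1], so the stable value is
   continuous in x. *)
Theorem homotopy_lift :
  exists L : X -> R, continuous L /\ forall x, cis (L x) = G (1, x).
Proof.
pose L x := lim (S n x @[n --> \oo]).
have stable n0 x : (forall n, (n0 <= n)%N -> good n x) -> L x = S n0 x.
  move=> gx; apply: lim_near_cst => //; exists n0 => // n /= n0n.
  elim: n n0n => [|n IH]; first by rewrite leqn0 => /eqP ->.
  rewrite leq_eqVlt => /orP[/eqP <-//|]; rewrite ltnS => n0n.
  by rewrite SS ?IH//; apply: gx => //; exact: leqW.
exists L; split => x; have [n0 gx] := good_near x.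
  have Lx := stable _ _ (nbhs_singleton gx).
  rewrite /continuous_at Lx.
  apply: (@cvg_trans _ (S n0 y @[y --> x])); last first.
    exact/S_cont/(nbhs_singleton gx).
  apply: near_eq_cvg; apply: filterS gx => y /stable Ly.
  by rewrite Ly.
by rewrite (stable _ _ (nbhs_singleton gx)) SE//; exact: (nbhs_singleton gx).
Qed.

End Lifting.

(** * Singular simplices *)

Lemma continuous_matrix_at (R : realType) (T : topologicalType) m n
    (f : T -> 'M[R]_(m, n)) (x : T) :
  (forall i j, {for x, continuous (fun y => f y i j)}) ->
  {for x, continuous f}.
Proof.
move=> fx B [P Px PB].
have : \forall y \near x, forall ij : 'I_m * 'I_n, P ij.1 ij.2 (f y ij.1 ij.2).
  by apply: filter_forall => -[i j]; exact: (fx i j _ (Px i j)).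
apply: filterS => y Py; apply: PB => i j; exact: (Py (i, j)).
Qed.

Section SimplexMaps.
Variable R : realType.

Definition bary n (x : simplex R n) (i : 'I_n.+1) : R := set_val x 0 i.

Lemma bary_ge0 n (x : simplex R n) i : 0 <= bary x i.
Proof. by case: x => x xS; have [x0 x1] := set_mem xS; exact: x0. Qed.

Lemma bary_sum n (x : simplex R n) : \sum_i bary x i = 1.
Proof. by case: x => x xS; have [x0 x1] := set_mem xS; exact: x1. Qed.

Lemma bary_continuous n i : continuous (@bary n ^~ i).
Proof.
move=> x; have sx := @initial_continuous _ _ (set_val : simplex R n ->
  'rV[R]_n.+1) x.
exact: (@continuous_comp (simplex R n) _ _ set_val
  (fun v : 'rV[R]_n.+1 => v 0 i) x sx (@coord_continuous _ _ _ 0 i _)).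
Qed.

Lemma simplex_ext n (x y : simplex R n) : (forall i, bary x i = bary y i) -> x
  = y.
Proof.
by move=> xy; apply: val_inj; apply/rowP => i; exact: xy.
Qed.

Lemma bary_face_lift n (i : 'I_n.+2) (x : simplex R n) k :
  bary (face_fun i x) (lift i k) = bary x k.
Proof. by rewrite /bary /= mxE liftK. Qed.

Lemma bary_face_same n (i : 'I_n.+2) (x : simplex R n) :
  bary (face_fun i x) i = 0.
Proof. by rewrite /bary /= mxE unlift_none. Qed.

(** Retraction of the line onto [0, 1]: homotopies can then be parametrised by all of [R], as
    [homotopy_lift] expects. *)
Definition clamp (s : R) : R := Num.max 0 (Num.min 1 s).

Lemma clamp_itv s : 0 <= clamp s <= 1.
Proof. by rewrite /clamp le_max lexx/= ge_max ler01 ge_min lexx. Qed.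

Lemma clampE s : 0 <= s <= 1 -> clamp s = s.
Proof. by move=> /andP[s0 s1]; rewrite /clamp min_r// max_r. Qed.

Lemma clamp_continuous : continuous clamp.
Proof.
move=> s; apply: (@continuous_max _ R (fun=> 0) (fun s => Num.min 1 s)).
  exact: cst_continuous.
apply: (@continuous_min _ R (fun=> 1) id).
  exact: cst_continuous.
exact: cvg_id.
Qed.

Definition contract_row n (s : R) (x : 'rV[R]_n.+1) : 'rV[R]_n.+1 :=
  \row_j (clamp s * x 0 j + (1 - clamp s) * (j == 0)%:R).

Lemma contract_simplex n s (x : simplex R n) :
  contract_row s (set_val x) \in @simplex_set R n.
Proof.
apply/mem_set; have /andP[s0 s1] := clamp_itv s; split => [i|].
  rewrite mxE addr_ge0// mulr_ge0// ?bary_ge0// ?subr_ge0//.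
under eq_bigr do rewrite mxE.
rewrite big_split/= -!mulr_sumr (bary_sum x) (bigD1 ord0)//= big1 => [|i
  /negPf->//].
by rewrite addr0 !mulr1 addrC subrK.
Qed.

Definition contract n (s : R) (x : simplex R n) : simplex R n :=
  exist _ (contract_row s (set_val x)) (contract_simplex s x).

Lemma contractE n s (x : simplex R n) i :
  bary (contract s x) i = clamp s * bary x i + (1 - clamp s) * (i == 0)%:R.
Proof. by rewrite /bary/= mxE. Qed.

Lemma continuous_simplex_at (T : topologicalType) n (f : T -> simplex R n) x :
  (forall i, {for x, continuous (fun y => bary (f y) i)}) ->
  {for x, continuous f}.
Proof.
move=> fx; apply: continuous_at_comp_initial.
by apply: continuous_matrix_at => i j; rewrite ord1; exact: fx.
Qed.

Lemma contract_continuous n : continuous (fun p : R * simplex R n => contract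
  p.1 p.2).
Proof.
move=> p; apply: continuous_simplex_at => i.
have cl : {for p, continuous (fun p : R * simplex R n => clamp p.1)}.
  apply: (@continuous_comp _ _ _ fst clamp); first exact: continuous_fst_at.
  exact: clamp_continuous.
rewrite (_ : (fun y => _) = (fun p : R * simplex R n =>
   clamp p.1 * bary p.2 i + (1 - clamp p.1) * (i == 0)%:R)); last first.
  by apply/funext => q; rewrite contractE.
apply: (@continuousD R R); apply: (@continuousM R) => //.
- apply: (@continuous_comp _ _ _ snd (@bary n ^~ i)).
    exact: continuous_snd_at.
  exact: bary_continuous.
- apply: (@continuousB R R) => //; exact: cst_continuous.
- exact: cst_continuous.
Qed.

Lemma contract0 n (x y : simplex R n) : contract 0 x = contract 0 y.
Proof.
by apply: simplex_ext => i; rewrite !contractE clampE ?lexx ?ler01// !mul0r.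
Qed.

Lemma contract1 n (x : simplex R n) : contract 1 x = x.
Proof.
apply: simplex_ext => i.
by rewrite contractE clampE ?lexx ?ler01// mul1r subrr mul0r addr0.
Qed.

Lemma simplex_lift n (s : simplex R n -> circle R) : continuous s ->
  exists L : simplex R n -> R, continuous L /\ forall x, cis (L x) = s x.
Proof.
move=> s_cont.
(* Dividing by the value at the apex makes [G] start at 1. That value is the same for all points, so
   its angle [a] is added back to the lift at the end. *)
pose G (p : R * simplex R n) := cmul (s (contract p.1 p.2)) (cinv (s (contract
  0 p.2))).
have s_contract : continuous (fun p : R * simplex R n => s (contract p.1 p.2)).
  move=> p; apply: (@continuous_comp _ _ _ (fun p : R * simplex R n => contract
    p.1 p.2) s).
    exact: contract_continuous.
  exact: s_cont.
have [||L [L_cont LE]] := @homotopy_lift R (simplex R n) G.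
- move=> p; apply: (@continuous_cmul R _ (fun p => s (contract p.1 p.2))
    (fun p => cinv (s (contract 0 p.2)))); first exact: s_contract.
  apply: continuous_cinv.
  apply: (@continuous_comp _ _ _ (fun p : R * simplex R n => (0 : R, p.2))
    (fun p : R * simplex R n => s (contract p.1 p.2))); last exact: s_contract.
  apply: continuous_pair_at; first exact: cst_continuous.
  exact: continuous_snd_at.
- by move=> x; rewrite /G cmulV.
have [[x0]|noX] := pselect (exists x : simplex R n, True); last first.
  by exists L; split => // x; case: noX; exists x.
move=> _; have [a aE] := cis_surj (s (contract 0 x0)).
exists (fun x => L x + a); split => x.
  by apply: (@continuousD R R); [exact: L_cont|exact: cst_continuous].
by rewrite cisD LE /G/= contract1 (contract0 x x0) aE cmulVK.
Qed.

End SimplexMaps.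

(** * Coning off a path in the plane *)

Section Cone.
Variable R : realType.

Local Notation plane := (R * R)%type.

Definition edge_row (s : R) : 'rV[R]_2 :=
  \row_j (if j == 0 then 1 - clamp s else clamp s).

Lemma edge_simplex (s : R) : edge_row s \in @simplex_set R 1.
Proof.
apply/mem_set; have /andP[s0 s1] := clamp_itv s; split => [i|].
  by rewrite mxE; case: ifP; rewrite ?subr_ge0.
by rewrite !big_ord_recl big_ord0 !mxE/= addr0 subrK.
Qed.

Definition edge (s : R) : simplex R 1 := exist _ (edge_row s) (edge_simplex s).

Lemma edgeE s : (bary (edge s) 0 = 1 - clamp s) * (bary (edge s) 1 = clamp s).
Proof. by rewrite /bary/= !mxE. Qed.

Lemma edge_continuous : continuous edge.
Proof.
move=> s; apply: continuous_simplex_at => i.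
rewrite (_ : (fun y => _) =
    (fun y => if i == 0 then 1 - clamp y else clamp y)); last first.
  by apply/funext => y; rewrite /bary/= mxE.
case: (i == 0); last exact: clamp_continuous.
apply: (@continuousB R R) => //; first exact: cst_continuous.
exact: clamp_continuous.
Qed.

Lemma bary_itv n (x : simplex R n) i : 0 <= bary x i <= 1.
Proof.
rewrite bary_ge0/= -(bary_sum x) (bigD1 i)//= lerDl sumr_ge0// => j _.
exact: bary_ge0.
Qed.

Lemma bary01 (x : simplex R 1) : bary x 0 + bary x 1 = 1.
Proof.
rewrite -(bary_sum x) !big_ord_recl big_ord0 addr0; congr (_ + bary x _).
exact: val_inj.
Qed.

Lemma edge_bary (x : simplex R 1) : edge (bary x 1) = x.
Proof.
apply: simplex_ext => i; case: (unliftP 0 i) => [j ->|->].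
  have -> : lift 0 j = 1 by rewrite ord1; exact: val_inj.
  by rewrite edgeE clampE// bary_itv.
by rewrite edgeE clampE ?bary_itv// -(bary01 x) addrK.
Qed.

(** The cone from the origin over [s]: [u] runs along the path, [v] along the rays. *)
Definition square_map (s : continuousType (simplex R 1) plane) (u v : R) :
  plane :=
  (v * (s (edge u)).1, v * (s (edge u)).2).

Lemma square_map_continuous s (T : topologicalType) (u v : T -> R) (x : T) :
  {for x, continuous u} -> {for x, continuous v} ->
  {for x, continuous (fun y => square_map s (u y) (v y))}.
Proof.
move=> ux vx.
have su : {for x, continuous (fun y => s (edge (u y)))}.
  apply: (@continuous_comp _ _ _ (fun y => edge (u y)) s).
    apply: (@continuous_comp _ _ _ u edge) => //; exact: edge_continuous.
  exact: cts_fun.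
have su1 : {for x, continuous (fun y => (s (edge (u y))).1)}.
  apply: (@continuous_comp _ _ _ (fun y => s (edge (u y))) fst x su).
  exact: continuous_fst_at.
have su2 : {for x, continuous (fun y => (s (edge (u y))).2)}.
  apply: (@continuous_comp _ _ _ (fun y => s (edge (u y))) snd x su).
  exact: continuous_snd_at.
apply: (@continuous_pair_at _ R R (fun y => v y * (s (edge (u y))).1)
  (fun y => v y * (s (edge (u y))).2)).
  exact: (continuousM vx su1).
exact: (continuousM vx su2).
Qed.

Definition square_simplex s n (u v : simplex R n -> R) (u_cont : continuous u)
    (v_cont : continuous v) : continuousType (simplex R n) plane :=
  mkcts (fun x => @square_map_continuous s _ u v x (u_cont x) (v_cont x)).

Lemma ray_continuous (p : plane) :
  continuous (fun x : simplex R 1 => (bary x 1 * p.1, bary x 1 * p.2)).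
Proof.
move=> x; apply: (@continuous_pair_at _ R R (fun x => bary x 1 * p.1)
  (fun x => bary x 1 * p.2)).
  exact: (continuousM (@bary_continuous R 1 1 x) (@cst_continuous _ _ p.1 x)).
exact: (continuousM (@bary_continuous R 1 1 x) (@cst_continuous _ _ p.2 x)).
Qed.

Definition ray (p : plane) : continuousType (simplex R 1) plane :=
  mkcts (@ray_continuous p).

Lemma face0E (x : simplex R 1) :
  (bary (face_fun 0 x) 1 = bary x 0) * (bary (face_fun 0 x) ord_max = bary x 1).
Proof.
split; rewrite -[RHS](bary_face_lift 0); congr (bary _ _); exact: val_inj.
Qed.

Lemma face1E (x : simplex R 1) :
  (bary (face_fun 1 x) 1 = 0) * (bary (face_fun 1 x) ord_max = bary x 1).
Proof.
split; first exact: bary_face_same.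
rewrite -[RHS](bary_face_lift 1); congr (bary _ _); exact: val_inj.
Qed.

Lemma face2E (x : simplex R 1) :
  (bary (face_fun ord_max x) 1 = bary x 1) *
  (bary (face_fun ord_max x) ord_max = 0).
Proof.
split; last exact: bary_face_same.
rewrite -[RHS](bary_face_lift ord_max); congr (bary _ _); exact: val_inj.
Qed.

Lemma boundary2 (X : topologicalType) (s : continuousType (simplex R 2) X) :
  boundary (<< s >> : chain R X 2) =
  << fcomp (face R 0) s >> - << fcomp (face R 1) s >> +
  << fcomp (face R ord_max) s >>.
Proof.
rewrite boundaryU scale1r !big_ord_recl big_ord0 addr0 addrA.
rewrite expr0 expr1 expr2 mulrN1 opprK !scale1r scaleN1r.
by congr (_ - << fcomp (face R _) s >> + << fcomp (face R _) s >>); exact: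
  val_inj.
Qed.

Let bary_sum12_continuous :
  continuous (fun x : simplex R 2 => bary x 1 + bary x ord_max).
Proof. by move=> x; apply: (@continuousD R R); exact: bary_continuous. Qed.

(* The square (u, v) |-> v * s(u) cut along its diagonal; three of its sides
   are the two rays and the constant path at the origin. *)
Lemma ray_homology (s : continuousType (simplex R 1) plane) :
  exists b : chain R plane 2,
    boundary b = << s >> - << ray (s (edge 1)) >> + << ray (s (edge 0)) >>.
Proof.
pose b2 := @bary_continuous R 2 ord_max.
(* [lo] is the triangle v <= u, [up] the triangle u <= v; face 1 of each is the diagonal. *)
pose lo := square_simplex s bary_sum12_continuous b2.
pose up := square_simplex s b2 bary_sum12_continuous.
pose pt n : continuousType (simplex R n) plane :=
  mkcts (fun x => @cst_continuous (simplex R n) plane (0, 0) x).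
(* The constant 2-simplex has boundary pt - pt + pt = pt, which cancels the constant side of
   [lo]. *)
exists (<< up >> - << lo >> + << pt 2 >>).
rewrite raddfD raddfB/= !boundary2.
have -> : fcomp (face R 0) up = s.
  apply/continuousEP => x; rewrite /fcomp/= /mkcts/= /square_map !face0E.
  by rewrite bary01 !mul1r edge_bary; case: (s x).
have -> : fcomp (face R 1) up = fcomp (face R 1) lo.
  apply/continuousEP => x; rewrite /fcomp/= /mkcts/= /square_map !face1E.
  by rewrite add0r.
have -> : fcomp (face R ord_max) up = ray (s (edge 0)).
  apply/continuousEP => x; rewrite /fcomp/= /mkcts/= /square_map !face2E.
  by rewrite addr0.
have -> : fcomp (face R 0) lo = ray (s (edge 1)).
  apply/continuousEP => x; rewrite /fcomp/= /mkcts/= /square_map !face0E.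
  by rewrite bary01.
have -> : fcomp (face R ord_max) lo = pt 1.
  apply/continuousEP => x; rewrite /fcomp/= /mkcts/= /square_map !face2E.
  by rewrite !mul0r.
have pt_face i : fcomp (face R i) (pt 2) = pt 1 by exact/continuousEP.
rewrite !pt_face subrr add0r opprD addrA subrK opprB.
by rewrite [_ - _ + << ray _ >>]addrAC addrA subrK addrAC.
Qed.

End Cone.

(** * Chains modulo boundaries *)

Section ChainsModBoundaries.
Variables (R : realType) (X : topologicalType).

Definition boundaries : {pred chain R X 1} :=
  fun c => `[< exists b : chain R X 2, boundary b = c >].

Lemma boundaries_zmod_closed : zmod_closed boundaries.
Proof.
split; first by apply/asboolP; exists 0; rewrite raddf0.
move=> c d /asboolP[b bc] /asboolP[b' bd]; apply/asboolP; exists (b - b').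
by rewrite raddfB/= bc bd.
Qed.

HB.instance Definition _ :=
  GRing.isZmodClosed.Build (chain R X 1) boundaries boundaries_zmod_closed.

(** All 1-chains, not only cycles, are taken modulo boundaries: a single path then has a class, and
    identities can be checked simplex by simplex. *)
Definition chain_class : zmodType := Quotient.quot boundaries.

Definition class (c : chain R X 1) : chain_class := (\pi_chain_class c)%qT.

Lemma class_is_zmod_morphism : zmod_morphism class.
Proof. by move=> c d; rewrite /class raddfB. Qed.

HB.instance Definition _ :=
  GRing.isZmodMorphism.Build (chain R X 1) chain_class class
    class_is_zmod_morphism.

Lemma class_eqP (c d : chain R X 1) :
  class c = class d <-> exists b : chain R X 2, boundary b = c - d.
Proof.
split=> [/eqP|cd]; first by rewrite -Quotient.idealrBE => /asboolP.
by apply/eqP; rewrite -Quotient.idealrBE; apply/asboolP.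
Qed.

End ChainsModBoundaries.

(** * The universal cover of the annulus *)

Section AnnulusCoordinates.
Variable R : realType.

Lemma logistic_subproof (t : R) :
  expR t / (1 + expR t) \in (`]0%R, 1%R[%classic : set R).
Proof.
have e0 := expR_gt0 t; have e1 : 0 < 1 + expR t by lra.
by apply/mem_set; rewrite /= in_itv/= divr_gt0//= ltr_pdivrMr// mul1r; lra.
Qed.

Definition logistic (t : R) : open_unit R :=
  exist _ (expR t / (1 + expR t)) (logistic_subproof t).

Definition uval (s : open_unit R) : R := set_val s.

Definition logit (s : open_unit R) : R := ln (uval s / (1 - uval s)).

Lemma open_unit_itv (s : open_unit R) : 0 < uval s < 1.
Proof. by case: s => s sS; have := set_mem sS; rewrite /= in_itv. Qed.

Lemma logitK : cancel logit logistic.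
Proof.
move=> s; have /andP[s0 s1] := open_unit_itv s.
have s10 : 0 < 1 - uval s by rewrite subr_gt0.
apply: val_inj; rewrite /= /logit lnK ?posrE ?divr_gt0//.
have ? : 1 - uval s != 0 by rewrite gt_eqF.
change (uval s / (1 - uval s) / (1 + uval s / (1 - uval s)) =
  uval s).
by field; apply/andP; split => //; rewrite subrK oner_neq0.
Qed.

Lemma logisticK : cancel logistic logit.
Proof.
move=> t; have e0 := expR_gt0 t.
have e1 : 1 + expR t != 0 by rewrite gt_eqF//; lra.
change (ln (expR t / (1 + expR t) / (1 - expR t / (1 + expR t))) = t).
rewrite (_ : expR t / (1 + expR t) / _ = expR t) ?expRK//.
by field; rewrite e1 /= addrK oner_neq0.
Qed.

Lemma logistic_continuous : continuous logistic.
Proof.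
move=> t; apply: continuous_at_comp_initial.
have ec : {for t, continuous (@expR R)} by exact: continuous_expR.
have e0 := expR_gt0 t.
have dc : {for t, continuous (fun x : R => (1 + expR x)^-1)}.
  apply: (@continuousV R _ (fun x : R => 1 + expR x)); first by rewrite
    gt_eqF//; lra.
  by apply: (@continuousD R R) => //; exact: cst_continuous.
exact: (continuousM ec dc).
Qed.

Lemma logit_continuous : continuous logit.
Proof.
move=> s; have /andP[s0 s1] := open_unit_itv s.
have s10 : 0 < 1 - uval s by rewrite subr_gt0.
have sc : {for s, continuous uval}.
  exact: initial_continuous.
have dc : {for s, continuous (fun x : open_unit R => (1 - uval x)^-1)}.
  apply: (@continuousV R _ (fun x : open_unit R => 1 - uval x)).
    by rewrite gt_eqF.
  by apply: (@continuousB R R) => //; exact: cst_continuous.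
have qc := continuousM sc dc.
apply: (@continuous_comp _ _ _ (fun x : open_unit R => uval x / (1 - uval x))
  (@ln R) s qc).
by apply: continuous_ln; rewrite divr_gt0.
Qed.

Local Notation plane := (R * R)%type.

Lemma unroll_continuous :
  continuous (fun v : plane => (logistic v.1, cis v.2) : annulus R).
Proof.
move=> v; apply: (@continuous_pair_at _ _ _ (fun v : plane => logistic v.1)
  (fun v : plane => cis v.2)).
  apply: (@continuous_comp _ _ _ fst logistic); first exact: continuous_fst_at.
  exact: logistic_continuous.
apply: (@continuous_comp _ _ _ snd (@cis R)); first exact: continuous_snd_at.
exact: cis_continuous.
Qed.

Definition unroll : continuousType plane (annulus R) := mkcts unroll_continuous.

(** The deck transformations of [unroll]. *)
Definition shift (k : int) (v : plane) : plane := (v.1, v.2 + (pi *+ 2) *~ k).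

Lemma unroll_shift k v : unroll (shift k v) = unroll v.
Proof. by rewrite /unroll/= /mkcts/= cis_period. Qed.

Lemma unroll_eq v w : unroll v = unroll w -> exists k, w = shift k v.
Proof.
move=> vw; have e1 : v.1 = w.1.
  exact: (can_inj logisticK (congr1 (fun a : annulus R => a.1) vw)).
have [k e2] := cis_eq (congr1 (fun a : annulus R => a.2) vw).
by exists k; rewrite /shift e1 -e2; case: w {vw e1 e2}.
Qed.

Lemma unroll_surj a : exists v, unroll v = a.
Proof.
case: a => s z; have [x <-] := cis_surj z.
by exists (logit s, x); rewrite /unroll/= /mkcts/= logitK.
Qed.

Lemma simplex_unroll n (s : continuousType (simplex R n) (annulus R)) :
  exists s' : continuousType (simplex R n) plane, fcomp s' unroll = s.
Proof.
have s1 : continuous (fun x => logit (s x).1).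
  move=> x; apply: (@continuous_comp _ _ _ (fun x => (s x).1) logit).
    apply: (@continuous_comp _ _ _ s fst); first exact: cts_fun.
    exact: continuous_fst_at.
  exact: logit_continuous.
have s2 : continuous (fun x => (s x).2).
  move=> x; apply: (@continuous_comp _ _ _ s snd); first exact: cts_fun.
  exact: continuous_snd_at.
have [L [Lc LE]] := simplex_lift s2.
have Sc : continuous (fun x => (logit (s x).1, L x)).
  move=> x.
  exact: (@continuous_pair_at _ R R (fun x => logit (s x).1) L x (s1 x) (Lc x)).
exists (mkcts Sc); apply/continuousEP => x.
by rewrite /fcomp/= /mkcts/= logitK LE; case: (s x).
Qed.

End AnnulusCoordinates.

Section ChainExtension.
Variables (R : realType) (X : topologicalType) (n : nat) (U : zmodType).

Lemma chain_ind (P : chain R X n -> Prop) :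
  P 0 -> (forall c d, P c -> P d -> P (c - d)) ->
  (forall s : continuousType (simplex R n) X, P << s >>) -> forall c, P c.
Proof.
move=> P0 PB P1.
have PN c : P c -> P (- c) by move=> Pc; rewrite -sub0r; exact: PB.
have PD c d : P c -> P d -> P (c + d).
  by move=> Pc Pd; rewrite -[d]opprK; apply: PB => //; exact: PN.
elim/freeg_ind_dom0 => // j s c _ _ Pc; apply: (PD) => //.
have -> : << j *g s >> = (<< s >> : chain R X n) *~ j by rewrite freegU_mulz
  intz.
have Pn (m : nat) : P ((<< s >> : chain R X n) *+ m).
  by elim: m => [|m IH]; rewrite ?mulr0n// mulrS; exact: PD.
case: j => m; first exact: Pn.
by rewrite NegzE mulrNz; apply: PN; exact: Pn.
Qed.

(** [fglift] targets modules over [int]; [zmodule U] is the abelian group [U] seen as one. *)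
Definition chain_extend (f : continuousType (simplex R n) X -> U) :
    chain R X n -> U := @fglift int (zmodule U) _ f.

HB.instance Definition _ f :=
  GRing.isZmodMorphism.Build (chain R X n) U (chain_extend f)
    (@lift_is_additive _ _ (zmodule U) f).

Lemma chain_extendU f s : chain_extend f << s >> = f s.
Proof. by rewrite /chain_extend liftU; exact: mulr1z. Qed.

End ChainExtension.

Section Vertices.
Variable R : realType.

Lemma vertex_subproof : const_mx 1 \in @simplex_set R 0.
Proof.
apply/mem_set; split => [i|]; first by rewrite mxE.
by rewrite big_ord_recl big_ord0 mxE addr0.
Qed.

Definition vertex : simplex R 0 :=
  exist _ (const_mx 1 : 'rV[R]_1) vertex_subproof.

Lemma bary_vertex i : bary vertex i = 1. Proof. by rewrite /bary/= mxE. Qed.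

(** Face 0 omits vertex 0, so it is the end point of the edge; face 1 is the starting point. *)
Lemma face0_vertex : face R 0 vertex = edge 1.
Proof.
apply: simplex_ext => i; case: (unliftP 0 i) => [j ->|->].
  rewrite [LHS](bary_face_lift 0 vertex j) bary_vertex.
  have -> : lift 0 j = 1 by rewrite ord1; exact: val_inj.
  by rewrite edgeE clampE ?ler01 ?lexx//.
by rewrite edgeE clampE ?ler01 ?lexx// subrr; exact: bary_face_same.
Qed.

Lemma face1_vertex : face R 1 vertex = edge 0.
Proof.
apply: simplex_ext => i; case: (unliftP 1 i) => [j ->|->].
  rewrite [LHS](bary_face_lift 1 vertex j) bary_vertex.
  have -> : lift 1 j = 0 by rewrite ord1; exact: val_inj.
  by rewrite edgeE clampE ?ler01 ?lexx// subr0.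
by rewrite edgeE clampE ?ler01 ?lexx//; exact: bary_face_same.
Qed.

Lemma boundary1 (X : topologicalType) (s : continuousType (simplex R 1) X) :
  boundary (<< s >> : chain R X 1) =
  << fcomp (face R 0) s >> - << fcomp (face R 1) s >>.
Proof.
rewrite boundaryU scale1r !big_ord_recl big_ord0 addr0.
rewrite expr0 expr1 !scale1r scaleN1r.
by congr (_ - << fcomp (face R _) s >>); exact: val_inj.
Qed.

End Vertices.

(** * Maps that double the deck translations have degree 2 *)

Section DegreeTwo.
Variable R : realType.
Local Notation plane := (R * R)%type.
Local Notation A := (annulus R).
Local Notation unroll := (unroll R).

(** A potential: by [class_path], the class of a path in the annulus is the difference of [k] at the
    ends of a lift. *)
Let k (v : plane) : chain_class R A := class << fcomp (ray v) unroll >>.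

Let class_path (s : continuousType (simplex R 1) plane) :
  class (<< fcomp s unroll >> : chain R A 1) = k (s (edge 1)) - k (s (edge 0)).
Proof.
rewrite /k -raddfB; apply/class_eqP.
have [b bE] := ray_homology s; exists (push unroll b).
by rewrite push_boundary bE raddfD raddfB/= !pushU !scale1r opprB addrA addrAC.
Qed.

Let segment_continuous (v w : plane) : continuous (fun x : simplex R 1 =>
  (v.1 + bary x 1 * (w.1 - v.1), v.2 + bary x 1 * (w.2 - v.2))).
Proof.
have aff (a b : R) x : {for x, continuous (fun x : simplex R 1 => a + bary x 1
  * b)}.
  apply: (@continuousD R R); first exact: cst_continuous.
  exact: (continuousM (@bary_continuous R 1 1 x) (@cst_continuous _ _ b x)).
by move=> x; exact: (@continuous_pair_at _ R R _ _ x (aff _ _ x) (aff _ _ x)).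
Qed.

Let shift_continuous j : continuous (@shift R j).
Proof.
move=> v; apply: (@continuous_pair_at _ R R fst (fun v => v.2 + (pi *+ 2) *~
  j)).
  exact: continuous_fst_at.
apply: (@continuousD R R); last exact: cst_continuous.
exact: continuous_snd_at.
Qed.

(** The segment from [v] to [w] and its translate have the same image in the annulus, so
    [class_path] gives two expressions of one class. *)
Let k_shift_sub j v w : k (shift j w) - k w = k (shift j v) - k v.
Proof.
pose s : continuousType (simplex R 1) plane := mkcts (@segment_continuous v w).
pose t : continuousType (simplex R 1) plane := fcomp s (mkcts
  (@shift_continuous j)).
have s0 : s (edge 0) = v.
  by rewrite /s/= /mkcts edgeE clampE ?lexx ?ler01// !mul0r !addr0; case: v {s
    t}.
have s1 : s (edge 1) = w.
  rewrite /s/= /mkcts edgeE clampE ?lexx ?ler01// !mul1r.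
  by rewrite !(addrC _ (_ - _)) !subrK; case: w {s t s0}.
have st : fcomp t unroll = fcomp s unroll.
  by apply/continuousEP => x; exact: unroll_shift.
have := class_path s; rewrite -st class_path s0 s1.
have -> : t (edge 1) = shift j w by rewrite -s1.
have -> : t (edge 0) = shift j v by rewrite -s0.
move/eqP; rewrite subr_eq => /eqP ->.
by rewrite addrAC [k w - k v - k w]addrAC subrr add0r addrC.
Qed.

Let k_shift2 j v w :
  k (shift (j + j) w) - k w = (k (shift j v) - k v) *+ 2.
Proof.
have -> : shift (j + j) w = shift j (shift j w).
  by rewrite /shift/= mulrzDr addrA.
rewrite mulr2n -{1}(k_shift_sub j v (shift j w)) -(k_shift_sub j v w).
by rewrite addrA subrK.
Qed.

Variables (f : continuousType A A) (F : continuousType plane plane).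
Hypothesis F_lift : fcomp F unroll = fcomp unroll f.
Hypothesis F_shift : forall v j, F (shift j v) = shift (j + j) (F v).

(** The defect between f_* and doubling, measured on the potential. Being periodic, it descends to
    the function [phi] on the annulus. *)
Let psi (v : plane) : chain_class R A := k (F v) - k v *+ 2.

Let psi_shift j v : psi (shift j v) = psi v.
Proof.
have := k_shift2 j v (F v); rewrite /psi F_shift => /eqP.
rewrite subr_eq => /eqP ->.
by rewrite mulrnBl addrAC [_ *+ 2 - _ - _]addrAC subrr add0r addrC.
Qed.

Let psi_unroll v w : unroll v = unroll w -> psi v = psi w.
Proof. by move=> /unroll_eq[j ->]; rewrite psi_shift. Qed.

Let section (a : A) : {v : plane | unroll v = a} := cid (unroll_surj a).

Let phi (a : A) : chain_class R A := psi (sval (section a)).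

Let phi_unroll v : phi (unroll v) = psi v.
Proof. by rewrite /phi; apply: psi_unroll; exact: (svalP (section _)). Qed.

Let class_push (s : continuousType (simplex R 1) A) :
  class (<< fcomp s f >> : chain R A 1) - class (<< s >> : chain R A 1) *+ 2 =
  phi (s (edge 1)) - phi (s (edge 0)).
Proof.
have [s' <-] := simplex_unroll s.
have -> : fcomp (fcomp s' unroll) f = fcomp (fcomp s' F) unroll.
  apply/continuousEP => x.
  by have /continuousEP/(_ (s' x)) := F_lift; rewrite /fcomp/=.
rewrite !class_path.
change (fcomp s' unroll (edge 1)) with (unroll (s' (edge 1))).
change (fcomp s' unroll (edge 0)) with (unroll (s' (edge 0))).
rewrite !phi_unroll /psi /fcomp/=.
by rewrite mulrnBl !opprD !opprK addrACA.
Qed.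

Lemma degree_two : has_degree f 2.
Proof.
elim/quotW => z; rewrite H1_map_pi -raddfMz.
apply/eqP; rewrite -Quotient.idealrBE; apply/asboolP.
have -> : cycle_chain (cycle_push f z - z *~ 2) =
    push f (cycle_chain z) - cycle_chain z *~ 2.
  by rewrite -[LHS]/(val _) raddfB/= raddfMz.
apply/class_eqP; case: z => c /= /eqP c0.
(* f_* - 2 factors through the boundary on all chains, which can be proved one simplex at a time. *)
have H (d : chain R A 1) : class (push f d) - class d *+ 2 =
    chain_extend (fun p : continuousType (simplex R 0) A => phi (p (vertex R)))
      (boundary d).
  elim/chain_ind: d => [|d e dE eE|s].
  - by rewrite !raddf0 mul0rn subrr.
  - rewrite !raddfB/=; rewrite -dE -eE mulrnBl.
    by rewrite !opprD !opprK addrACA.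
  - by rewrite pushU scale1r class_push boundary1 [RHS]raddfB/= !chain_extendU
    /fcomp/= face0_vertex face1_vertex.
have := H c; rewrite c0 raddf0 => /eqP; rewrite subr_eq0 => /eqP ->.
by rewrite raddfMz.
Qed.

End DegreeTwo.

(** * Winding numbers *)

Section Winding.
Variable R : realType.

Lemma cis_pi_neq : cis (pi : R) <> cis 0.
Proof. by move/(congr1 (@cre R)); rewrite !cisE cospi cos0; lra. Qed.

(** The values of [g] are multiples of 2 pi; between two distinct ones the intermediate value
    theorem would give a multiple plus pi, where [cis] is -1. *)
Lemma cis1_path_const (g : R -> R) : continuous g ->
  (forall t, cis (g t) = cis 0) -> forall a b, g a = g b.
Proof.
move=> g_cont g1 a b.
wlog ab : a b / a <= b => [hw|].
  by have [/hw//|/ltW/hw->] := leP a b.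
have [ka gaE] := cis_eq (esym (g1 a)); have [kb gbE] := cis_eq (esym (g1 b)).
move: gaE gbE; rewrite !add0r => gaE gbE.
have pi0 := pi_gt0 R.
have IVTg := IVT ab (continuous_subspaceT g_cont).
have nopi (k : int) c : g c <> (pi *+ 2) *~ k + pi.
  by move=> gc; apply: cis_pi_neq; rewrite -(g1 c) gc addrC cis_period.
have p2 : 0 < pi *+ 2 :> R by rewrite pmulrn_lgt0.
have [kk|kk|kk] := ltgtP ka kb; last by rewrite gaE gbE kk.
- have gap : g a + pi *+ 2 <= g b.
    by rewrite gaE gbE -[X in _ + X]mulr1z -mulrzDr ler_pMz2l// lezD1.
  have [|c _] := IVTg (g a + pi).
    rewrite ge_min le_max; apply/andP; split; apply/orP; [left|right]; lra.
  by rewrite {1}gaE => /nopi.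
- have gap : g b + pi *+ 2 <= g a.
    by rewrite gaE gbE -[X in _ + X]mulr1z -mulrzDr ler_pMz2l// lezD1.
  have [|c _] := IVTg (g b + pi).
    rewrite ge_min le_max; apply/andP; split; apply/orP; [right|left]; lra.
  by rewrite {1}gbE => /nopi.
Qed.

(** The contraction [c] joins every point by a path to one common point. *)
Lemma cis1_const (X : topologicalType) (c : R * X -> X) (D : X -> R) :
  continuous c -> (forall x y, c (0, x) = c (0, y)) -> (forall x, c (1, x) = x)
    ->
  continuous D -> (forall x, cis (D x) = cis 0) -> forall x y, D x = D y.
Proof.
move=> c_cont c0 c1 D_cont D1 x y.
have path z : D z = D (c (0, z)).
  rewrite -{1}(c1 z); apply: (@cis1_path_const (fun t => D (c (t, z)))) => // t.
  apply: (@continuous_comp _ _ _ (fun t => c (t, z)) D); last exact: D_cont.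
  apply: (@continuous_comp _ _ _ (fun t : R => (t, z)) c); last exact: c_cont.
  exact: (@continuous_pair_at _ R X id (fun=> z) t (@cvg_id _ _)
    (@cst_continuous _ _ z t)).
by rewrite path (c0 x y) -path.
Qed.

Lemma simplex_lift_diff n (L M : simplex R n -> R) :
  continuous L -> continuous M -> (forall x, cis (L x) = cis (M x)) ->
  forall x y, L x - L y = M x - M y.
Proof.
move=> Lc Mc LM x y.
have D_cont : continuous (fun x => L x - M x).
  by move=> z; exact: (continuousB (Lc z) (Mc z)).
have D1 z : cis (L z - M z) = cis 0 by rewrite cisD cisN LM cmulV.
have := @cis1_const _ (fun p : R * simplex R n => contract p.1 p.2) _
  (@contract_continuous R n) (@contract0 R n) (@contract1 R n) D_cont D1 x y.
lra.
Qed.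

Definition angle_lift n (s : continuousType (simplex R n) (circle R)) :
    simplex R n -> R := sval (cid (simplex_lift (@cts_fun _ _ s))).

Lemma angle_lift_continuous n s : continuous (@angle_lift n s).
Proof. by rewrite /angle_lift; case: cid => L []. Qed.

Lemma angle_liftE n s x : cis (@angle_lift n s x) = s x.
Proof. by rewrite /angle_lift; case: cid => L []. Qed.

(** The total angle swept, in radians, for paths that may fail to close up; by [windE] any
    continuous lift computes it. *)
Definition wind (s : continuousType (simplex R 1) (circle R)) : R :=
  angle_lift s (edge 1) - angle_lift s (edge 0).

Lemma windE (s : continuousType (simplex R 1) (circle R)) (L : simplex R 1 ->
  R) : continuous L ->
  (forall x, cis (L x) = s x) -> wind s = L (edge 1) - L (edge 0).
Proof.
move=> Lc LE; apply: simplex_lift_diff => //.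
  exact: angle_lift_continuous.
by move=> x; rewrite angle_liftE LE.
Qed.

Lemma edge1E : edge (1 : R) = face_fun 0 (vertex R).
Proof. by rewrite -face0_vertex. Qed.

Lemma edge0E : edge (0 : R) = face_fun 1 (vertex R).
Proof. by rewrite -face1_vertex. Qed.

Lemma bary_edge (i : 'I_2) : (bary (edge (0 : R)) i = (i == 0)%:R) *
  (bary (edge (1 : R)) i = (i == 1)%:R).
Proof.
rewrite /bary/= !mxE !clampE ?lexx ?ler01// subr0 subrr.
by case: i => -[|[|]].
Qed.

(** Each vertex of the triangle is an end of two of its edges; this makes the winding along a
    boundary telescope. *)
Lemma face_edge : [/\ face_fun (1 : 'I_3) (edge (1 : R)) = face_fun 0 (edge 1),
  face_fun (ord_max : 'I_3) (edge (1 : R)) = face_fun 0 (edge 0) &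
  face_fun (ord_max : 'I_3) (edge (0 : R)) = face_fun 1 (edge 0)].
Proof.
have tot (x y : simplex R 2) :
    bary x 1 = bary y 1 -> bary x ord_max = bary y ord_max -> x = y.
  move=> e1 e2; apply: simplex_ext => i.
  have := bary_sum x; rewrite -(bary_sum y) !big_ord_recl !big_ord0 !addr0.
  have -> : lift ord0 ord0 = 1 :> 'I_3 by exact: val_inj.
  have -> : lift ord0 (lift ord0 ord0) = ord_max :> 'I_3 by exact: val_inj.
  rewrite e1 e2 => /addIr e0.
  case: i => -[|[|[|//]]] i3.
  - by rewrite (_ : Ordinal i3 = ord0) //; exact: val_inj.
  - by rewrite (_ : Ordinal i3 = 1) //; exact: val_inj.
  - by rewrite (_ : Ordinal i3 = ord_max) //; exact: val_inj.
by split; apply: tot; rewrite !(face0E, face1E, face2E) !bary_edge.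
Qed.

Local Notation winding := (chain_extend wind).

Lemma winding_boundary (b : chain R (circle R) 2) : winding (boundary b) = 0.
Proof.
elim/chain_ind: b => [|c d cE dE|s]; first by rewrite raddf0 [LHS]raddf0.
  by rewrite raddfB/= [LHS]raddfB/= cE dE subrr.
rewrite boundary2 [LHS]raddfD/= raddfB/= !chain_extendU.
have Lc := @angle_lift_continuous 2 s; set L := angle_lift s.
have face_wind i : wind (fcomp (face R i) s) =
    L (face_fun i (edge 1)) - L (face_fun i (edge 0)).
  apply: (@windE _ (fun x => L (face_fun i x))) => x.
    apply: (@continuous_comp _ _ _ (face_fun i) L); last exact: Lc.
    exact: face_continuous.
  by rewrite angle_liftE.
rewrite !face_wind; have [-> -> ->] := face_edge; ring.
Qed.

Lemma loop_continuous : continuous (fun x : simplex R 1 => cis (pi *+ 2 * bary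
  x 1)).
Proof.
move=> x.
apply: (@continuous_comp _ _ _ (fun x : simplex R 1 => pi *+ 2 * bary x 1)
  (@cis R)).
  exact: (continuousM (@cst_continuous _ _ (pi *+ 2) x) (@bary_continuous R 1 1
    x)).
exact: cis_continuous.
Qed.

Definition loop : continuousType (simplex R 1) (circle R) := mkcts
  loop_continuous.

Lemma winding_loop : winding << loop >> = pi *+ 2.
Proof.
rewrite chain_extendU.
have Lc : continuous (fun x : simplex R 1 => pi *+ 2 * bary x 1).
  by move=> x; exact: (continuousM (@cst_continuous _ _ (pi *+ 2) x)
    (@bary_continuous R 1 1 x)).
by rewrite (windE Lc)// !bary_edge/= mulr0 mulr1 subr0.
Qed.

Lemma simplex0_eq (x : simplex R 0) : x = vertex R.
Proof.
apply: simplex_ext => i; have := bary_sum x.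
by rewrite big_ord_recl big_ord0 addr0 bary_vertex (ord1 i) => ->.
Qed.

Lemma loop_cycle : is_cycle (<< loop >> : chain R (circle R) 1).
Proof.
rewrite /is_cycle/= boundary1 subr_eq0; apply/eqP; congr (<< _ >>).
apply/continuousEP => x; rewrite (simplex0_eq x) /fcomp/= /mkcts/=.
rewrite -edge0E -edge1E !bary_edge/= mulr1 mulr0.
by have := cis_period (0 : R) 1; rewrite add0r mulr1z.
Qed.

Variables (X : topologicalType) (h : continuousType X (circle R)).

(* If h lifts to a real function along every path, up to a function of the end
   points alone, then the winding number of h_* c only depends on the boundary
   of c. *)
Lemma H1_map_not_surjective (eta : X -> R) :
  (forall s : continuousType (simplex R 1) X,
    wind (fcomp s h) = eta (s (edge 1)) - eta (s (edge 0))) ->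
  ~ bijective (H1_map R h).
Proof.
move=> h_eta [g _ gK].
(* The class of [loop] has no preimage: its winding is 2 pi, that of every h_* z is 0. *)
pose l : Defs.cycle R (circle R) := Cycle loop_cycle.
have := gK (\pi_(H1 R (circle R)) l)%qT.
elim/quotW: (g _) => z; rewrite H1_map_pi => /eqP.
rewrite -Quotient.idealrBE => /asboolP[b].
have -> : cycle_chain (cycle_push h z - l) = push h (cycle_chain z) - << loop
  >>.
  by rewrite -[LHS]/(val _) raddfB.
move/(congr1 winding); rewrite winding_boundary [RHS]raddfB/= winding_loop.
case: z => c /= /eqP c0.
have H (d : chain R X 1) : winding (push h d) = chain_extend
    (fun p : continuousType (simplex R 0) X => eta (p (vertex R))) (boundary d).
  elim/chain_ind: d => [|d e dE eE|s].
  - by rewrite !raddf0.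
  - by rewrite !raddfB/= dE eE.
  - by rewrite pushU scale1r chain_extendU h_eta boundary1 [RHS]raddfB/=
      !chain_extendU /fcomp/= face0_vertex face1_vertex.
rewrite H c0 raddf0; have := pi_gt0 R; lra.
Qed.

End Winding.

(** * Lifting maps from the annulus to the circle *)

Section AnnulusToCircle.
Variables (R : realType) (h : continuousType (annulus R) (circle R)).
Local Notation plane := (R * R)%type.

Lemma plane_contract_continuous :
  continuous (fun p : R * plane => (p.1 * p.2.1, p.1 * p.2.2)).
Proof.
move=> p; have p1 := @continuous_fst_at R plane p.
have p2 := @continuous_snd_at R plane p.
have p21 : {for p, continuous (fun p : R * plane => p.2.1)}.
  apply: (@continuous_comp _ _ _ snd fst p p2); exact: continuous_fst_at.
have p22 : {for p, continuous (fun p : R * plane => p.2.2)}.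
  apply: (@continuous_comp _ _ _ snd snd p p2); exact: continuous_snd_at.
exact: (@continuous_pair_at _ R R _ _ p (continuousM p1 p21) (continuousM p1
  p22)).
Qed.

Lemma plane_const (D : plane -> R) : continuous D ->
  (forall v, cis (D v) = cis 0) -> forall v w, D v = D w.
Proof.
apply: (cis1_const plane_contract_continuous).
  by move=> v w; rewrite /= !mul0r.
by move=> [t x]; rewrite /= !mul1r.
Qed.

Lemma plane_lift : exists H : plane -> R,
  continuous H /\ forall v, cis (H v) = h (unroll R v).
Proof.
pose u (v : plane) := h (unroll R v).
have u_cont : continuous u.
  by move=> v; apply: (@continuous_comp _ _ _ (unroll R) h); exact: cts_fun.
pose c (p : R * plane) : plane := (p.1 * p.2.1, p.1 * p.2.2).
pose G (p : R * plane) := cmul (u (c p)) (cinv (u (0, 0))).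
have [||H [H_cont HE]] := @homotopy_lift R plane G.
- move=> p; apply: (@continuous_cmul R _ (fun p => u (c p)) (fun=> cinv (u (0,
  0)))).
    apply: (@continuous_comp _ _ _ c u); last exact: u_cont.
    exact: plane_contract_continuous.
  exact: cst_continuous.
- by move=> v; rewrite /G /c/= !mul0r cmulV.
have [a aE] := cis_surj (u (0, 0)).
exists (fun v => H v + a); split => v.
  exact: (continuousD (H_cont v) (@cst_continuous _ _ a v)).
by rewrite cisD HE /G /c/= !mul1r aE cmulVK; case: v.
Qed.

(** A periodic lift descends to [eta] on the annulus, and the image under [h] of a path sweeps the
    difference of [eta] at its ends. *)
Lemma periodic_lift_not_bijective (H : plane -> R) : continuous H ->
  (forall v, cis (H v) = h (unroll R v)) -> (forall k v, H (shift k v) = H v) ->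
  ~ bijective (H1_map R h).
Proof.
move=> H_cont HE H_per.
pose eta (a : annulus R) := H (sval (cid (unroll_surj a))).
have etaE v : eta (unroll R v) = H v.
  rewrite /eta; case: cid => w /= /esym/unroll_eq[k ->]; exact: H_per.
apply: (@H1_map_not_surjective R _ h eta) => s.
have [s' <-] := simplex_unroll s.
have Lc : continuous (fun x => H (s' x)).
  by move=> x; apply: (@continuous_comp _ _ _ s' H); [exact: cts_fun|exact:
    H_cont].
rewrite (windE Lc) => [|x]; last by rewrite HE.
by rewrite -!etaE.
Qed.

End AnnulusToCircle.

(** * The square map *)

Section SquareCovering.
Variables (R : realType) (X T : topologicalType).
Variables (psi : X -> T * circle R) (psi' : T * circle R -> X).
Hypotheses (psi_cont : continuous psi) (psi'_cont : continuous psi').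
Hypotheses (psiK : cancel psi psi') (psi'K : cancel psi' psi).

Let p (a : X) : T * circle R := ((psi a).1, cmul (psi a).2 (psi a).2).

Let arg_pi : circle R := cis pi.

Let cre_opp z : cre (cmul z arg_pi) = - cre z.
Proof. by rewrite cmulE !cisE cospi sinpi; ring. Qed.

Lemma circle_sqrt (w : circle R) : exists c, cmul c c = w.
Proof.
have [x <-] := cis_surj w; exists (cis (x / 2)).
by rewrite -cisD -splitr.
Qed.

(** The square root with positive real part when [0 < cre v]. *)
Let half (v : circle R) : circle R := cis (clog v / 2).

Let half_sq v : 0 < cre v -> cmul (half v) (half v) = v.
Proof.
by move=> v0; rewrite /half -cisD -splitr clogK.
Qed.

Let half_pos v : 0 < cre (half v).
Proof.
rewrite cisE; apply: cos_gt0_pihalf; have := clog_le v; rewrite ler_norml.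
by have := pi_gt0 R; move=> ? /andP[? ?]; apply/andP; split; lra.
Qed.

Let sq_half v : 0 < cre v -> 0 < cre (cmul v v) -> half (cmul v v) = v.
Proof.
move=> v0 vv0; rewrite /half clogM//.
have -> : (clog v + clog v) / 2 = clog v by lra.
exact: clogK.
Qed.

Let quo_sq (y c : circle R) : cmul (cmul y y) (cinv (cmul c c)) =
  cmul (cmul y (cinv c)) (cmul y (cinv c)).
Proof. by apply: circle_ext; rewrite !(cmulE, cinvE); ring. Qed.

Let U (w : circle R) : set (T * circle R) := [set b | 0 < cre (cmul b.2 (cinv
  w))].

(** The sheet over the half circle centred at c^2 whose circle coordinate is nearer to the root c
    than to -c. *)
Let V (c : circle R) : set X :=
  [set a | U (cmul c c) (p a) /\ 0 < cre (cmul (psi a).2 (cinv c))].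

Let s (c : circle R) (b : T * circle R) : X :=
  psi' (b.1, cmul c (half (cmul b.2 (cinv (cmul c c))))).

Let p_cont : continuous p.
Proof.
move=> a.
have p1 : {for a, continuous (fun a => (psi a).1)}.
  apply: (@continuous_comp _ _ _ psi fst a (psi_cont (x:=a))).
  exact: continuous_fst_at.
have p2 : {for a, continuous (fun a => (psi a).2)}.
  apply: (@continuous_comp _ _ _ psi snd a (psi_cont (x:=a))).
  exact: continuous_snd_at.
exact: (@continuous_pair_at _ T (circle R) _ _ a p1 (continuous_cmul p2 p2)).
Qed.

Let quo_cont w (b : T * circle R) :
  {for b, continuous (fun b : T * circle R => cmul b.2 (cinv w))}.
Proof.
apply: continuous_cmul; first exact: continuous_snd_at.
exact: (@cst_continuous _ _ (cinv w)).
Qed.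

Let U_open w : open (U w).
Proof.
have := @open_comp (T * circle R)%type R
  (fun b : T * circle R => cre (cmul b.2 (cinv w))) [set x | 0 < x].
apply; last exact: open_gt.
move=> b _; apply: (@continuous_comp _ _ _ (fun b : T * circle R => cmul b.2
  (cinv w)) (@cre R)).
  exact: quo_cont.
exact: cre_continuous.
Qed.

Let V_open c : open (V c).
Proof.
apply: (@openI _ (p @^-1` U (cmul c c)) [set a | 0 < cre (cmul (psi a).2 (cinv
  c))]).
  by apply: open_comp => [a _|]; [exact: p_cont|exact: U_open].
have -> : [set a | 0 < cre (cmul (psi a).2 (cinv c))] = psi @^-1` U c by [].
by apply: open_comp => [a _|]; [exact: psi_cont|exact: U_open].
Qed.

Let s_cont c b : U (cmul c c) b -> {for b, continuous (s c)}.
Proof.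
move=> Ub; apply: (@continuous_comp _ _ _ (fun b : T * circle R =>
  (b.1, cmul c (half (cmul b.2 (cinv (cmul c c)))))) psi'); last exact:
    psi'_cont.
apply: (@continuous_pair_at _ T (circle R) fst
  (fun b => cmul c (half (cmul b.2 (cinv (cmul c c)))))).
  exact: continuous_fst_at.
apply: continuous_cmul; first exact: (@cst_continuous _ _ c).
have lc : {for b, continuous (fun b : T * circle R =>
    clog (cmul b.2 (cinv (cmul c c))))}.
  apply: (@continuous_comp _ _ _ (fun b : T * circle R => cmul b.2 (cinv (cmul
    c c)))
    (@clog R) b (@quo_cont _ b)).
  exact: clog_continuous.
apply: (@continuous_comp _ _ _ (fun b : T * circle R =>
  clog (cmul b.2 (cinv (cmul c c))) / 2) (@cis R)); last exact: cis_continuous.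
exact: (continuousM lc (@cst_continuous _ R 2^-1 b)).
Qed.

Let pK c : {in V c, cancel p (s c)}.
Proof.
move=> a /set_mem[/= Ua Va]; rewrite /s /= quo_sq sq_half//; last by rewrite
  -quo_sq.
by rewrite cmulC cmulVK -[RHS]psiK; case: (psi a).
Qed.

Let sK c b : U (cmul c c) b -> V c (s c b) /\ p (s c b) = b.
Proof.
move=> Ub; have psb : p (s c b) = b.
  rewrite /p /s psi'K /=; case: b Ub => b1 b2 Ub /=; congr (_, _).
  set q := half _; have -> : cmul (cmul c q) (cmul c q) = cmul (cmul q q) (cmul
    c c).
    by apply: circle_ext; rewrite !cmulE; ring.
  by rewrite half_sq// cmulVK.
split => //; split; first by rewrite psb.
rewrite /s psi'K /= cmulC cmulA [cmul (cinv c) c]cmulC cmulV cmulC cmul1.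
exact: half_pos.
Qed.

Let V_homeo c : homeo_on p (V c) (U (cmul c c)).
Proof.
split.
- split.
  + by move=> a [].
  + by move=> a a' Va Va' paa'; rewrite -(pK Va) -(pK Va') paa'.
  + by move=> b /sK[Vb pb]; exists (s c b).
- exact: continuous_subspaceT.
- exists (s c); split; last exact: pK.
  by apply: continuous_in_subspaceT => b /set_mem; exact: s_cont.
Qed.

Lemma square_covering : covering_map p.
Proof.
split; first exact: p_cont.
- move=> [t w] _; have [c cw] := circle_sqrt w; exists (psi' (t, c)) => //.
  by rewrite /p psi'K /= cw.
move=> [t w]; exists (U w); split; [exact: U_open| |].
  by rewrite /U/= cmulV cis0E.
exists [set V c | c in [set c | cmul c c = w]]; last first.
  by move=> _ [c cw <-]; rewrite -cw; split; [exact: V_open|exact: V_homeo].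
split.
  apply/seteqP; split => a.
    move=> Ua; have [c cw] := circle_sqrt w.
    subst w; have := Ua; rewrite /U/= quo_sq; set q := cmul (psi a).2 (cinv c)
      => q0.
    (* q^2 has positive real part, so q is off the imaginary axis; the sign of [cre q] selects the
       sheet of c or of -c. *)
    have q_neq : cre q != 0.
      apply/eqP => q00; move: q0; rewrite cmulE q00.
      by have := cre2Dcim2 q; rewrite q00; nra.
    have [qpos|qneg|/eqP] := ltgtP 0 (cre q); last by rewrite eq_sym (negPf
      q_neq).
      by exists (V c); [exists c|split].
    exists (V (cmul c arg_pi)); first exists (cmul c arg_pi) => //.
      by apply: circle_ext; rewrite !cmulE !cisE cospi sinpi; ring.
    split.
      rewrite (_ : cmul (cmul c arg_pi) _ = cmul c c)//.
      by apply: circle_ext; rewrite !cmulE !cisE cospi sinpi; ring.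
    rewrite (_ : cmul (psi a).2 _ = cmul q arg_pi) ?cre_opp ?oppr_gt0//.
    by apply: circle_ext; rewrite !(cmulE, cinvE) !cisE cospi sinpi; ring.
  by move=> [_ [c /= cw <-] []]; rewrite cw.
move=> _ _ [c cw <-] [d dw <-] [a [[/= ca2 ca] [/= da2 da]]]; congr V.
(* Relative to [c] and to [d], the common point gives square roots of the same number with positive
   real part, hence the same quotient. *)
have qr : cmul (psi a).2 (cinv c) = cmul (psi a).2 (cinv d).
  rewrite /U/= quo_sq in ca2; rewrite /U/= quo_sq in da2.
  by rewrite -(sq_half ca ca2) -(sq_half da da2) -!quo_sq cw dw.
rewrite -(cmulK c (cmul (psi a).2 (cinv c))) [cmul c _]cmulC cmulVK qr.
by rewrite -{1}(cmulVK (psi a).2 d) [cmul _ d]cmulC cmulK.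
Qed.

End SquareCovering.

(** * The example *)

Section Example.
Variable R : realType.
Local Notation plane := (R * R)%type.
Local Notation A := (annulus R).

Definition tower (t : R) : R := expR (expR t).

Definition twist (a : A) : A :=
  let t := logit a.1 in let y := cmul a.2 (cis (tower t)) in
  (logistic (t + ln (3 + cim y)), y).

(** The output shows y itself, so the height shift can be undone first; the old height then
    determines the rotation. *)
Definition untwist (b : A) : A :=
  let t := logit b.1 - ln (3 + cim b.2) in
  (logistic t, cmul b.2 (cinv (cis (tower t)))).

Definition example_fun (a : A) : A := ((twist a).1, cmul (twist a).2 (twist
  a).2).

Lemma tower_continuous : continuous tower.
Proof.
by move=> t; apply: (@continuous_comp _ _ _ (@expR R) (@expR R)); exact:
  continuous_expR.
Qed.

Lemma ln3_continuous_at (T : topologicalType) (g : T -> R) x :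
  -1 <= g x -> {for x, continuous g} ->
  {for x, continuous (fun y => ln (3 + g y))}.
Proof.
move=> gx g_cont; apply: (@continuous_comp _ _ _ (fun y => 3 + g y) (@ln R)).
  exact: (continuousD (@cst_continuous _ R 3 x) g_cont).
by apply: continuous_ln; lra.
Qed.

Lemma twist_continuous : continuous twist.
Proof.
move=> a.
have tc : {for a, continuous (fun a : A => logit a.1)}.
  apply: (@continuous_comp _ _ _ fst (@logit R)); first exact:
    continuous_fst_at.
  exact: logit_continuous.
have Bc : {for a, continuous (fun a : A => cis (tower (logit a.1)))}.
  apply: (@continuous_comp _ _ _ (fun a : A => tower (logit a.1)) (@cis R)).
    apply: (@continuous_comp _ _ _ (fun a : A => logit a.1) tower a tc).
    exact: tower_continuous.
  exact: cis_continuous.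
pose y (a : A) := cmul a.2 (cis (tower (logit a.1))).
have yc : {for a, continuous y}.
  by apply: continuous_cmul; [exact: continuous_snd_at|exact: Bc].
have lc : {for a, continuous (fun a => ln (3 + cim (y a)))}.
  apply: ln3_continuous_at; first by have /andP[] := cim_itv (y a).
  by apply: (@continuous_comp _ _ _ y (@cim R) a yc); exact: cim_continuous.
apply: (@continuous_pair_at _ _ _ (fun a : A => logistic (logit a.1 + ln (3 +
  cim (y a)))) y) => //.
apply: (@continuous_comp _ _ _ (fun a : A => logit a.1 + ln (3 + cim (y a)))
  (@logistic R)).
  exact: (continuousD tc lc).
exact: logistic_continuous.
Qed.

Lemma untwist_continuous : continuous untwist.
Proof.
move=> b.
have sc : {for b, continuous (fun b : A => logit b.1)}.
  apply: (@continuous_comp _ _ _ fst (@logit R)); first exact: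
    continuous_fst_at.
  exact: logit_continuous.
have lc : {for b, continuous (fun b : A => ln (3 + cim b.2))}.
  apply: ln3_continuous_at; first by have /andP[] := cim_itv b.2.
  apply: (@continuous_comp _ _ _ snd (@cim R)); first exact: continuous_snd_at.
  exact: cim_continuous.
pose t (b : A) := logit b.1 - ln (3 + cim b.2).
have tc : {for b, continuous t} := continuousB sc lc.
apply: (@continuous_pair_at _ _ _ (fun b : A => logistic (t b))
  (fun b : A => cmul b.2 (cinv (cis (tower (t b)))))).
  by apply: (@continuous_comp _ _ _ t (@logistic R) b tc); exact:
    logistic_continuous.
apply: continuous_cmul; first exact: continuous_snd_at.
apply: continuous_cinv.
apply: (@continuous_comp _ _ _ (fun b : A => tower (t b)) (@cis R)).
  by apply: (@continuous_comp _ _ _ t tower b tc); exact: tower_continuous.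
exact: cis_continuous.
Qed.

Lemma twistK : cancel twist untwist.
Proof.
move=> [s z]; rewrite /untwist /twist /= logisticK addrK logitK.
by rewrite cmulK.
Qed.

Lemma untwistK : cancel untwist twist.
Proof.
move=> [s z]; rewrite /untwist /twist /= logisticK cmulVK subrK logitK.
by [].
Qed.

Lemma example_covering : covering_map example_fun.
Proof.
exact: (square_covering twist_continuous untwist_continuous twistK untwistK).
Qed.

Lemma example_continuous : continuous example_fun.
Proof. by have [] := example_covering. Qed.

Definition example : continuousType A A := mkcts example_continuous.

Definition strip_fun (v : plane) : plane :=
  let y := v.2 + tower v.1 in (v.1 + ln (3 + sin y), y + y).

Lemma strip_continuous : continuous strip_fun.
Proof.
move=> v.
have yc : {for v, continuous (fun v : plane => v.2 + tower v.1)}.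
  have tc : {for v, continuous (fun v : plane => tower v.1)}.
    apply: (@continuous_comp _ _ _ fst tower); first exact: continuous_fst_at.
    exact: tower_continuous.
  exact: (continuousD (@continuous_snd_at R R v) tc).
have lc : {for v, continuous (fun v : plane => ln (3 + sin (v.2 + tower v.1)))}.
  apply: ln3_continuous_at; first exact: sin_geN1.
  apply: (@continuous_comp _ _ _ (fun v : plane => v.2 + tower v.1) (@sin R) v
    yc).
  exact: continuous_sin.
exact: (@continuous_pair_at _ R R _ _ v (continuousD (@continuous_fst_at R R v)
  lc)
  (continuousD yc yc)).
Qed.

Definition strip : continuousType plane plane := mkcts strip_continuous.

Lemma strip_lift : fcomp strip (unroll R) = fcomp (unroll R) example.
Proof.
apply/continuousEP => v.
rewrite /fcomp/= /mkcts/= /example_fun /twist /= logisticK.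
by rewrite -!cisD.
Qed.

Lemma strip_shift v j : strip (shift j v) = shift (j + j) (strip v).
Proof.
rewrite /strip/= /mkcts/= /strip_fun /shift/=.
have -> : v.2 + pi *+ 2 *~ j + tower v.1 = v.2 + tower v.1 + pi *+ 2 *~ j.
  by rewrite addrAC.
have -> : sin (v.2 + tower v.1 + pi *+ 2 *~ j) = sin (v.2 + tower v.1).
  by have /(congr1 (@cim R)) := cis_period (v.2 + tower v.1) j.
by rewrite mulrzDr addrACA.
Qed.

Lemma example_degree : has_degree example 2.
Proof. exact: degree_two strip_lift strip_shift. Qed.

End Example.

(** * Growth bounds and the contradiction *)

Section NotSemiconjugate.
Variable R : realType.
Local Notation plane := (R * R)%type.
Local Notation A := (annulus R).

Lemma bounded_on_rectangle (u : plane -> R) (a b : R) : continuous u ->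
  exists M, forall v : plane, 0 <= v.1 <= a -> 0 <= v.2 <= b -> `|u v| <= M.
Proof.
move=> u_cont.
have cK := compact_setX (@segment_compact R 0 a) (@segment_compact R 0 b).
have /compact_bounded[M [_ uM]] := continuous_compact (continuous_subspaceT
  u_cont) cK.
exists (M + 1) => v v1 v2; apply: (uM (M + 1)); first by rewrite ltrDl.
by exists v => //; split; rewrite /= in_itv.
Qed.

Lemma strip_surj (w : plane) : exists v, strip R v = w.
Proof.
case: w => t' x'; pose y := x' / 2; pose t := t' - ln (3 + sin y).
exists (t, y - tower t); rewrite /strip/= /mkcts/= /strip_fun/= subrK -splitr.
by rewrite subrK.
Qed.

Lemma strip_expR (v : plane) :
  expR (strip R v).1 = expR v.1 * (3 + sin (v.2 + tower v.1)).
Proof.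
rewrite /strip/= /mkcts/= /strip_fun/= expRD lnK// posrE.
have := sin_geN1 (v.2 + tower v.1); lra.
Qed.

(* Each step of the strip map multiplies exp t by a factor between 2 and 4, so
   a function with u (F v) = 2 u(v) + O(exp (exp t)) is controlled by its values
   on the fundamental domain 1 <= exp t <= 4. *)
Lemma tower_growth (u : plane -> R) (m M : R) :
  (forall v, u (strip R v) = u v *+ 2 - (m * tower v.1) *+ 2) ->
  (forall v, 1 <= expR v.1 <= 4 -> `|u v| <= M) -> 0 <= M ->
  exists C, [/\ 0 <= C, (forall v, 1 <= expR v.1 -> `|u v| <= C * tower v.1) &
    forall v, 4 < expR v.1 -> `|u v| <= C * 4 * expR (expR v.1 / 2)].
Proof.
(* [C] dominates both [M], for the fundamental domain, and [|m|], so that one step yields 2 C + 2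
   [|m|] <= 4 C. *)
move=> uF uM M0; pose C := M + `|m|.
have C0 : 0 <= C by rewrite addr_ge0.
have step v : 4 < expR v.1 ->
    (forall w, 1 <= expR w.1 -> expR w.1 <= expR v.1 / 2 -> `|u w| <= C * tower
      w.1) ->
    `|u v| <= C * 4 * expR (expR v.1 / 2).
  move=> v4 IH; have [w wv] := strip_surj v.
  have rE := strip_expR w; rewrite wv in rE.
  have s1 := sin_geN1 (w.2 + tower w.1); have s2 := sin_le1 (w.2 + tower w.1).
  have w0 := expR_gt0 w.1.
  (* The factor 3 + sin is at most 4, so a preimage of a point beyond 4 stays above 1. *)
  have w1 : 1 <= expR w.1 by nra.
  have w2 : expR w.1 <= expR v.1 / 2 by nra.
  have uw := IH w w1 w2.
  have tw : tower w.1 <= expR (expR v.1 / 2) by rewrite ler_expR.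
  have t0 : 0 <= tower w.1 by exact: expR_ge0.
  rewrite -wv uF; apply: le_trans (ler_normB _ _) _.
  rewrite !normrMn normrM (ger0_norm t0) wv.
  have mC : `|m| <= C by rewrite lerDr.
  have mt : `|m| * tower w.1 <= C * expR (expR v.1 / 2) by rewrite ler_pM.
  have Ct : C * tower w.1 <= C * expR (expR v.1 / 2) by rewrite ler_wpM2l.
  lra.
have double v : 4 < expR v.1 -> C * 4 * expR (expR v.1 / 2) <= C * tower v.1.
  move=> v4; rewrite /tower -mulrA ler_wpM2l//.
  rewrite [in leRHS](splitr (expR v.1)) expRD ler_wpM2r ?expR_ge0//.
  (* 4 <= e^2 because e >= 2, and e^2 <= exp (x / 2) for x = [expR v.1] > 4. *)
  apply: (@le_trans _ _ (expR (1 + 1))); last by rewrite ler_expR; lra.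
  have := expR_ge1Dx (1 : R); rewrite expRD; nra.
have all (n : nat) v : 1 <= expR v.1 -> expR v.1 <= 4 * 2 ^+ n -> `|u v| <= C *
  tower v.1.
  elim: n v => [|n IH] v v1.
    rewrite expr0 mulr1 => v4; apply: (@le_trans _ _ (C * 1)).
      by rewrite mulr1; apply: le_trans (uM _ _) _; rewrite ?v1// lerDl.
    by rewrite ler_wpM2l// /tower -expR0 ler_expR expR_ge0.
  have [v4 _|v4 vn] := leP (expR v.1) (4 * 2 ^+ n); first exact: IH.
  have v4' : 4 < expR v.1.
    by apply: le_lt_trans v4; rewrite ler_peMr// exprn_ege1// ler1n.
  apply: (@le_trans _ _ (C * 4 * expR (expR v.1 / 2))); last exact: double.
  apply: step => // w w1 w2; apply: IH => //.
  by apply: le_trans w2 _; rewrite exprS in vn; lra.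
have all' v : 1 <= expR v.1 -> `|u v| <= C * tower v.1.
  move=> v1; apply: (all (Num.bound (expR v.1))) => //.
  apply: (@le_trans _ _ (2 ^+ Num.bound (expR v.1))).
    exact/ltW/upper_nthrootP.
  by rewrite ler_peMl ?exprn_ge0// ler1n.
exists C; split => // v v4; apply: step => // w w1 _; exact: all'.
Qed.

(** At y = pi / 2 the height rises by ln 4, at y = 3 pi / 2 by ln 2 only, which absorbs the offset
    ln 2; the doubled angles differ by 2 pi. *)
Lemma strip_collision (t : R) :
  strip R (t + ln 2, pi / 2 + pi - tower (t + ln 2)) =
  shift 1 (strip R (t, pi / 2 - tower t)).
Proof.
rewrite /strip/= /mkcts/= /strip_fun /shift/= !subrK sinDpi sin_pihalf mulr1z.
congr (_, _); last by rewrite mulr2n; ring.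
have -> : (3 + 1 : R) = (3 - 1) * 2 by ring.
by rewrite lnM ?posrE; [ring|lra|lra].
Qed.

(** With r = exp t and T = exp r, the towers at t and t + ln 2 are T and T^2. The sharper bound at
    the upper point is 4 C T, so [|m|] (T^2 - T) <= 5 C T, which fails for large r. *)
Lemma tower_gap (u : plane -> R) (m C : R) : 0 < `|m| -> 0 <= C ->
  (forall v, 1 <= expR v.1 -> `|u v| <= C * tower v.1) ->
  (forall v, 4 < expR v.1 -> `|u v| <= C * 4 * expR (expR v.1 / 2)) ->
  ~ forall t, u (t + ln 2, pi / 2 + pi - tower (t + ln 2)) -
              u (t, pi / 2 - tower t) = m * (tower (t + ln 2) - tower t).
Proof.
move=> m0 C0 uC uC4 gap; have [r [r5 mr]] : exists r, 5 <= r /\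
    `|m| * r = 5 * C + 5 * `|m|.
  (* The summand 5 leaves a positive excess of [|m| * r] over 5 C, and puts r and 2 r in the ranges
     of the two bounds. *)
  exists (5 * C / `|m| + 5); split; first by rewrite lerDr divr_ge0// mulr_ge0.
  by rewrite mulrDr mulrCA divff ?gt_eqF// mulr1 [`|m| * 5]mulrC.
have r0 : 0 < r by lra.
have tr : expR (ln r) = r by rewrite lnK// posrE.
have t2r : expR (ln r + ln 2) = r * 2 by rewrite expRD tr lnK// posrE.
have b1 := uC (ln r, pi / 2 - tower (ln r)).
have b2 := uC4 (ln r + ln 2, pi / 2 + pi - tower (ln r + ln 2)).
have := gap (ln r); move: b1 b2.
set a := u _; set b := u _; rewrite /= /tower !t2r !tr mulfK// mulr_natr mulr2n
  expRD.
have : 1 + r <= expR r by exact: expR_ge1Dx.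
move: (expR r) => T T1 b1 b2 ab.
have {}b1 : `|a| <= C * T by apply: b1; lra.
have {}b2 : `|b| <= C * 4 * T by apply: b2; lra.
have : `|m| * (T * T - T) <= C * 4 * T + C * T.
  apply: le_trans (lerD b2 b1); apply: le_trans (ler_normB _ _).
  by rewrite ab normrM ler_wpM2l// ler_norm.
have -> : `|m| * (T * T - T) = (`|m| * (T - 1)) * T by ring.
have -> : C * 4 * T + C * T = (5 * C) * T by ring.
rewrite ler_pM2r; last lra.
have : `|m| * r <= `|m| * (T - 1) by rewrite ler_pM2l//; lra.
lra.
Qed.

Lemma example_not_semiconjugate : ~ semiconjugate_pow (example R) 2.
Proof.
have halve (a b e k : R) : b + b + k = a + a + k + e -> b = a + e / 2 by lra.
move=> [h [hf h_bij]].
have [H [H_cont HE]] := plane_lift h.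
have h_strip v : h (unroll R (strip R v)) = cmul (h (unroll R v)) (h (unroll R
  v)).
  have /continuousEP/(_ v) := strip_lift R; rewrite /fcomp/= => ->.
  by rewrite -circle_pow2; exact: (congr1 (fun g => g (unroll R v)) hf).
have strip_cont : continuous (strip R) by exact: cts_fun.
have Hs_cont : continuous (fun v => H (strip R v)).
  by move=> v; apply: (@continuous_comp _ _ _ (strip R) H); [exact:
    strip_cont|exact: H_cont].
have shift_cont : continuous (@shift R 1).
  move=> v; apply: (@continuous_pair_at _ R R fst (fun v => v.2 + (pi *+ 2) *~
    1)).
    exact: continuous_fst_at.
  exact: (continuousD (@continuous_snd_at R R v) (@cst_continuous _ R _ v)).
have HT_cont : continuous (fun v => H (shift 1 v)).
  by move=> v; apply: (@continuous_comp _ _ _ (shift 1) H); [exact: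
    shift_cont|exact: H_cont].
(* [H] after a shift lifts the same circle map as [H], and [H] after the strip map the same one as 2
   [H]; such lifts differ by constants, here [E] and [K]. *)
pose E := H (shift 1 (0, 0)) - H (0, 0).
have HT v : H (shift 1 v) = H v + E.
  suff -> : E = H (shift 1 v) - H v by rewrite addrC subrK.
  apply: (@plane_const R (fun v => H (shift 1 v) - H v)).
    by move=> w; exact: (continuousB (HT_cont w) (H_cont w)).
  by move=> w; rewrite cisD cisN !HE unroll_shift cmulV.
pose K := H (strip R (0, 0)) - (H (0, 0) + H (0, 0)).
have HF v : H (strip R v) = H v + H v + K.
  suff -> : K = H (strip R v) - (H v + H v) by rewrite addrC subrK.
  apply: (@plane_const R (fun v => H (strip R v) - (H v + H v))).
    by move=> w; exact: (continuousB (Hs_cont w) (continuousD (H_cont w)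
      (H_cont w))).
  by move=> w; rewrite cisD cisN cisD !HE h_strip cmulV.
have periodic (g : plane -> R) : (forall v, g (shift 1 v) = g v) ->
    forall k v, g (shift k v) = g v.
  move=> g1; have gn (n : nat) v : g (shift n v) = g v.
    elim: n v => [|n IH] v; first by rewrite /shift mulr0z addr0; case: v.
    rewrite -[RHS]IH -[RHS]g1; congr g; rewrite /shift/=.
    by rewrite intS mulrzDr [_ *~ 1 + _]addrC addrA.
  case=> n v; first exact: gn.
  rewrite -(gn n.+1); congr g; rewrite /shift/= NegzE mulrNz subrK.
  by case: v.
have E0 : E != 0.
  apply/eqP => E0; apply: (periodic_lift_not_bijective H_cont HE) h_bij.
  by apply: periodic => v; rewrite HT E0 addr0.
have pi0 := pi_gt0 R.
pose m := E / (pi *+ 2).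
have mE : m * (pi *+ 2) = E by rewrite /m divfK// mulrn_eq0/= gt_eqF.
have m0 : 0 < `|m| by rewrite normr_gt0 mulf_neq0// invr_neq0// mulrn_eq0/=
  gt_eqF.
(* Adding [K] turns H o F = 2 H + K into exact doubling; subtracting m x cancels the increment [E]
   per period. *)
pose u (v : plane) := H v + K - m * v.2.
have u_cont : continuous u.
  move=> v; apply: (@continuousB R R _ (fun v => H v + K) (fun v => m * v.2)).
    exact: (continuousD (H_cont v) (@cst_continuous _ R K v)).
  exact: (continuousM (@cst_continuous _ R m v) (@continuous_snd_at R R v)).
have u_per := periodic u _.
have {}u_per : forall k v, u (shift k v) = u v.
  by apply: u_per => v; rewrite /u HT /shift/= mulr1z mulrDr mE; ring.
have uF v : u (strip R v) = u v *+ 2 - (m * tower v.1) *+ 2.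
  by rewrite /u HF /strip/= /mkcts/= !mulr2n; ring.
have [M0 uM0] := bounded_on_rectangle (ln 4) (pi *+ 2) u_cont.
have uM v : 1 <= expR v.1 <= 4 -> `|u v| <= `|M0|.
  (* Translating by the floor brings the angle into one period, and 1 <= exp t <= 4 reads 0 <= t <=
     ln 4: a compact rectangle. *)
  move=> /andP[v1 v4]; pose k := Num.floor (v.2 / (pi *+ 2)).
  rewrite -(u_per (- k)); apply: le_trans (ler_norm _); apply: uM0 => /=.
    have l0 : 0 <= v.1 by rewrite -ler_expR expR0.
    by rewrite l0 -ler_expR lnK// posrE.
  have /andP[] := floor_itv (v.2 / (pi *+ 2)).
  have p2 : 0 < pi *+ 2 :> R by rewrite mulrn_wgt0.
  rewrite -/k ler_pdivlMr// ltr_pdivrMr// intrD mulrDl !mulrzl mulr1z mulrNz.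
  by move=> lo hi; apply/andP; split; lra.
have [C [C0 uC uC4]] := tower_growth uF uM (normr_ge0 M0).
apply: (tower_gap m0 C0 uC uC4) => t.
(* The images under the strip map differ by one period, so 2 [H] differs by [E] exactly, as real
   numbers. *)
have Hq : H (t + ln 2, pi / 2 + pi - tower (t + ln 2)) =
    H (t, pi / 2 - tower t) + E / 2.
  by apply: (halve _ _ _ K); rewrite -HF strip_collision HT HF.
by rewrite /u Hq -mE /= -mulr_natr; field.
Qed.

End NotSemiconjugate.

Theorem mainTheorem7 (R : realType) :
  exists (d : int) (f : continuousType (annulus R) (annulus R)),
    [/\ 1 < `|d|, covering_map f, has_degree f d & ~ semiconjugate_pow f d].
Proof.
exists 2, (example R); split => //.
- exact: example_covering.
- exact: example_degree.
- exact: example_not_semiconjugate.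
Qed.
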